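(* Let $M\in\mathbb{R}^{n\times m}$ and let $k\ge 1$ be the factorization rank. Consider the line search interior point algorithm described in the context (Algorithm IP) for the problem $\min\{\tfrac12\|XY-M\|_F^2 : X\in\mathbb{R}^{n\times k},\ Y\in\mathbb{R}^{k\times m},\ X\ge 0,\ Y\ge 0\}$, with tolerance $\epsilon_{TOL}>0$. Suppose that all the sequences $\{x_\ell\}$, $\{y_\ell\}$, $\{r_\ell\}$, $\{s_\ell\}$ generated by Algorithm IP are bounded. Then Algorithm IP stops in finitely many iterations; that is, after finitely many (inner and outer) iterations the outer stopping criterion $E(x_\ell,y_\ell,r_\ell,s_\ell;0)\le\epsilon_{TOL}$ is satisfied.
   Context: **Variables.** Inequalities between vectors or matrices are entrywise. $\mathrm{vec}$ stacks the columns of a matrix into a vector. For $X\in\mathbb{R}^{n\times k}$, $Y\in\mathbb{R}^{k\times m}$ put $x=\mathrm{vec}(X^T)\in\mathbb{R}^{nk}$, $y=\mathrm{vec}(Y)\in\mathbb{R}^{mk}$. The dual variables are $r\in\mathbb{R}^{nk}$, $s\in\mathbb{R}^{mk}$. $X_i$ is the $i$th row of $X$ and $Y_j$ the $j$th column of $Y$. $\mathrm{Diag}(v)$ is the diagonal matrix with diagonal $v$, $e$ is a vector of ones of the appropriate size, $I$ is an identity matrix, $\|\cdot\|$ is the Euclidean norm, and $$\mathrm{graX}=\mathrm{vec}\big(Y(XY-M)^T\big),\qquad \mathrm{graY}=\mathrm{vec}\big(X^T(XY-M)\big).$$ **Matrices.** $Q_1$ is block diagonal with $n$ diagonal blocks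 all equal to $YY^T$; $Q_2$ is block diagonal with $m$ diagonal blocks all equal to $X^TX$. $\bar C\in\mathbb{R}^{mk\times nk}$ is the block matrix whose $(j,i)$ block ($1\le j\le m$, $1\le i\le n$) is the $k\times k$ matrix $X_i^TY_j^T$. $C\in\mathbb{R}^{mk\times nk}$ is the block matrix whose $(j,i)$ block is $X_i^TY_j^T+(X_iY_j-M_{ij})I$. **Error function.** For $\mu\ge0$, $$E(x,y,r,s;\mu)=\max\left\{\left\|\begin{pmatrix}\mathrm{graX}-r\\ \mathrm{graY}-s\end{pmatrix}\right\|,\ \left\|\begin{pmatrix}\mathrm{Diag}(x)r\\ \mathrm{Diag}(y)s\end{pmatrix}-\mu e\right\|\right\}.$$ **Merit function.** For $x,y>0$ and the current $\mu$, $$\phi(x,y)=\tfrac12\|XY-M\|_F^2-\mu\sum_i\log x_i-\mu\sum_j\log y_j .$$ **Primal-dual direction.** With a fixed small constant $\rho>0$, $(\Delta x,\Delta y,\Delta r,\Delta s)$ is the solution of $$\begin{pmatrix}Q_1+\rho I&\bar C^T&-I&0\\ \bar C&Q_2+\rho I&0&-I\\ \mathrm{Diag}(r)&0&\mathrm{Diag}(x)&0\\ 0&\mathrm{Diag}(s)&0&\mathrm{Diag}(y)\end{pmatrix}\begin{pmatrix}\Delta x\\ \Delta y\\ \Delta r\\ \Delta s\end{pmatrix}=\begin{pmatrix}r-\mathrm{graX}\\ s-\mathrm{graY}\\ \mu e-\mathrm{Diag}(r)x\\ \mu e-\mathrm{Diag}(s)y\end{pmatrix}.\qquad(\mathrm{D})$$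 **Fraction to the boundary rule.** For $\tau\in(0,1)$ fixed (the choice made is $\tau=0.9$), $$\alpha_1^{\max}=\max\{\alpha\in(0,1]: x+\alpha\Delta x\ge(1-\tau)x,\ y+\alpha\Delta y\ge(1-\tau)y\},$$ $$\alpha_2^{\max}=\max\{\alpha\in(0,1]: r+\alpha\Delta r\ge(1-\tau)r,\ s+\alpha\Delta s\ge(1-\tau)s\}.$$ **Choice of $\sigma$.** At the current iterate, the affine scaling (predictor) direction $(\Delta x^{aff},\Delta y^{aff},\Delta r^{aff},\Delta s^{aff})$ is the solution of the Newton system $$\begin{pmatrix}Q_1&C^T&-I&0\\ C&Q_2&0&-I\\ \mathrm{Diag}(r)&0&\mathrm{Diag}(x)&0\\ 0&\mathrm{Diag}(s)&0&\mathrm{Diag}(y)\end{pmatrix}\begin{pmatrix}\Delta x\\ \Delta y\\ \Delta r\\ \Delta s\end{pmatrix}=\begin{pmatrix}r-\mathrm{graX}\\ s-\mathrm{graY}\\ -\mathrm{Diag}(r)x\\ -\mathrm{Diag}(s)y\end{pmatrix}.$$ The step lengths $\alpha_1^{aff},\alpha_2^{aff}$ are given by the formulas for $\alpha_1^{\max},\alpha_2^{\max}$ with $\tau=1$ and the affine scaling direction. Then $$\mu^{aff}=\frac{(x+\alpha_1^{aff}\Delta x^{aff})^T(r+\alpha_2^{aff}\Delta r^{aff})+(y+\alpha_1^{aff}\Delta y^{aff})^T(s+\alpha_2^{aff}\Delta s^{aff})}{nk+mk},$$ $$\sigma=\min\left\{\left(\frac{\mu^{aff}}{(x^Tr+y^Ts)/(nk+mk)}\right)^3,\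 0.99\right\}.$$ **Algorithm IP.** Initialize: choose $x_0,y_0,r_0,s_0>0$, an initial barrier parameter $\mu>0$, a parameter $\eta\in(0,1)$, positive tolerances $\epsilon_\mu$ decreasing to $0$ as $\mu$ is decreased to $0$ (for instance $\epsilon_\mu=\mu$), and $\epsilon_{TOL}>0$. Set $\ell=0$. Outer loop: repeat until $E(x_\ell,y_\ell,r_\ell,s_\ell;0)\le\epsilon_{TOL}$: 1. Inner loop ($\mu$ fixed): repeat until $E(x_\ell,y_\ell,r_\ell,s_\ell;\mu)\le\epsilon_\mu$: - compute $(\Delta x,\Delta y,\Delta r,\Delta s)$ from (D) at $(x_\ell,y_\ell,r_\ell,s_\ell)$; - compute $\alpha_1^{\max},\alpha_2^{\max}$ by the fraction to the boundary rule; - set $\alpha_2=\alpha_2^{\max}$ and $\alpha_1=2^{-t}\alpha_1^{\max}$, where $t\ge0$ is the smallest integer with $$\phi(x_\ell+\alpha_1\Delta x,\,y_\ell+\alpha_1\Delta y)\le\phi(x_\ell,y_\ell)+\eta\,\alpha_1(\Delta x^T,\Delta y^T)\nabla\phi(x_\ell,y_\ell);$$ - set $x_{\ell+1}=x_\ell+\alpha_1\Delta x$, $y_{\ell+1}=y_\ell+\alpha_1\Delta y$, $r_{\ell+1}=r_\ell+\alpha_2\Delta r$, $s_{\ell+1}=s_\ell+\alpha_2\Delta s$, and $\ell:=\ell+1$. 2. After the inner loop ends, compute, at the current iterate $(x,y,r,s)=(x_\ell,y_\ell,r_\ell,s_\ell)$, the affine scaling direction $(\Delta x^{aff},\Delta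 y^{aff},\Delta r^{aff},\Delta s^{aff})$, the step lengths $\alpha_1^{aff},\alpha_2^{aff}$, the value $\mu^{aff}$, and then $\sigma=\min\left\{\left(\frac{\mu^{aff}}{(x^Tr+y^Ts)/(nk+mk)}\right)^3,\ 0.99\right\}$, and update $\mu:=\sigma\mu$.
   Formalization: It is additionally assumed that the affine scaling Newton system has a solution whenever it is called for, and that μ>0 whenever the inner loop is run; σ=0 would give μ=0 and ε_μ=0, and the inner loop would then never end. *)

(* Defs.v *)
(* MathComp / MathComp-Analysis *)
From HB Require Import structures.
From mathcomp Require Import all_boot all_order all_algebra.
From mathcomp Require Import all_classical all_reals all_analysis.

Set Implicit Arguments.
Unset Strict Implicit.
Unset Printing Implicit Defensive.

Import Order.TTheory GRing.Theory Num.Theory.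
Import numFieldNormedType.Exports.

Local Open Scope classical_set_scope.
Local Open Scope ring_scope.

(* Frobenius norm of a matrix; on a column it is the Euclidean norm.  (The
   norm `|A| of MathComp-Analysis on matrices is the max norm.) *)
Definition l2norm (R : realType) (p q : nat) (A : 'M[R]_(p, q)) : R :=
  Num.sqrt (\sum_i \sum_j A i j ^+ 2).

Definition mx_le (R : realType) (p q : nat) (A B : 'M[R]_(p, q)) : Prop :=
  forall i j, A i j <= B i j.

Definition mx_pos (R : realType) (p q : nat) (A : 'M[R]_(p, q)) : Prop :=
  forall i j, 0 < A i j.

Definition Diag (R : realType) (p : nat) (v : 'cV[R]_p) : 'M[R]_p :=
  diag_mx v^T.

Definition ones (R : realType) (p : nat) : 'cV[R]_p := const_mx 1.

Definition inner (R : realType) (p : nat) (u v : 'cV[R]_p) : R :=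
  (u^T *m v) 0 0.

(* MathComp's mxvec concatenates rows, so the column-stacking vec of A is
   obtained from A^T. *)
Definition vec (R : realType) (p q : nat) (A : 'M[R]_(p, q)) : 'cV[R]_(q * p) :=
  (mxvec A^T)^T.

Definition unvec (R : realType) (p q : nat) (v : 'cV[R]_(q * p)) :
    'M[R]_(p, q) :=
  (vec_mx v^T)^T.

Lemma vecK (R : realType) (p q : nat) :
  cancel (@vec R p q) (@unvec R p q).
Proof. by move=> A; rewrite /unvec /vec trmxK mxvecK trmxK. Qed.

Lemma unvecK (R : realType) (p q : nat) :
  cancel (@unvec R p q) (@vec R p q).
Proof. by move=> v; rewrite /unvec /vec trmxK vec_mxK trmxK. Qed.

(* Inverse of mxvec_index: the block number and the position in the block. *)
Definition mxvec_unindex (p k : nat) (u : 'I_(p * k)) : 'I_p * 'I_k :=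
  enum_val (cast_ord (esym (mxvec_cast p k)) u).

Lemma mxvec_indexK (p k : nat) (i : 'I_p) (a : 'I_k) :
  mxvec_unindex (mxvec_index i a) = (i, a).
Proof. by rewrite /mxvec_unindex /mxvec_index cast_ordK enum_rankK. Qed.

(* The p x q block matrix whose (j, i) block is the k x k matrix B j i. *)
Definition blocks (R : realType) (p q k : nat)
    (B : 'I_p -> 'I_q -> 'M[R]_k) : 'M[R]_(p * k, q * k) :=
  \matrix_(u, v) B (mxvec_unindex u).1 (mxvec_unindex v).1
                   (mxvec_unindex u).2 (mxvec_unindex v).2.

Lemma blocksE (R : realType) (p q k : nat) (B : 'I_p -> 'I_q -> 'M[R]_k)
    (j : 'I_p) (a : 'I_k) (i : 'I_q) (b : 'I_k) :
  blocks B (mxvec_index j a) (mxvec_index i b) = B j i a b.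
Proof. by rewrite mxE !mxvec_indexK. Qed.

(* X from x = vec X^T, and Y from y = vec Y. *)
Definition matX (R : realType) (n k : nat) (x : 'cV[R]_(n * k)) : 'M[R]_(n, k) :=
  (unvec x)^T.

Definition matY (R : realType) (m k : nat) (y : 'cV[R]_(m * k)) : 'M[R]_(k, m) :=
  unvec y.

Definition graX (R : realType) (n m k : nat) (M : 'M[R]_(n, m))
    (x : 'cV[R]_(n * k)) (y : 'cV[R]_(m * k)) : 'cV[R]_(n * k) :=
  let X := matX x in let Y := matY y in vec (Y *m (X *m Y - M)^T).

Definition graY (R : realType) (n m k : nat) (M : 'M[R]_(n, m))
    (x : 'cV[R]_(n * k)) (y : 'cV[R]_(m * k)) : 'cV[R]_(m * k) :=
  let X := matX x in let Y := matY y in vec (X^T *m (X *m Y - M)).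

Definition Q1 (R : realType) (n m k : nat) (y : 'cV[R]_(m * k)) :
    'M[R]_(n * k) :=
  let Y := matY y in
  blocks (fun i i' : 'I_n => if i == i' then Y *m Y^T else 0).

Definition Q2 (R : realType) (n m k : nat) (x : 'cV[R]_(n * k)) :
    'M[R]_(m * k) :=
  let X := matX x in
  blocks (fun j j' : 'I_m => if j == j' then X^T *m X else 0).

Definition Cbar (R : realType) (n m k : nat)
    (x : 'cV[R]_(n * k)) (y : 'cV[R]_(m * k)) : 'M[R]_(m * k, n * k) :=
  let X := matX x in let Y := matY y in
  blocks (fun (j : 'I_m) (i : 'I_n) => (row i X)^T *m (col j Y)^T).

Definition C (R : realType) (n m k : nat) (M : 'M[R]_(n, m))
    (x : 'cV[R]_(n * k)) (y : 'cV[R]_(m * k)) : 'M[R]_(m * k, n * k) :=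
  let X := matX x in let Y := matY y in
  blocks (fun (j : 'I_m) (i : 'I_n) =>
    (row i X)^T *m (col j Y)^T + ((row i X *m col j Y) 0 0 - M i j)%:M).

(* Used both for iterates (x, y, r, s) and for directions (dx, dy, dr, ds). *)
Record pd_point (R : realType) (n m k : nat) := Point {
  px : 'cV[R]_(n * k);
  py : 'cV[R]_(m * k);
  pr : 'cV[R]_(n * k);
  ps : 'cV[R]_(m * k) }.

Definition stack (R : realType) (n m k : nat) (w : pd_point R n m k) :=
  col_mx (col_mx (px w) (py w)) (col_mx (pr w) (ps w)).

Definition positive (R : realType) (n m k : nat) (w : pd_point R n m k) : Prop :=
  [/\ mx_pos (px w), mx_pos (py w), mx_pos (pr w) & mx_pos (ps w)].

Definition E (R : realType) (n m k : nat) (M : 'M[R]_(n, m))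
    (w : pd_point R n m k) (mu : R) : R :=
  Num.max
    (l2norm (col_mx (graX M (px w) (py w) - pr w)
                    (graY M (px w) (py w) - ps w)))
    (l2norm (col_mx (Diag (px w) *m pr w) (Diag (py w) *m ps w)
             - mu *: ones R (n * k + m * k))).

Definition phi (R : realType) (n m k : nat) (M : 'M[R]_(n, m)) (mu : R)
    (x : 'cV[R]_(n * k)) (y : 'cV[R]_(m * k)) : R :=
  2^-1 * l2norm (matX x *m matY y - M) ^+ 2
  - mu * (\sum_i ln (x i 0)) - mu * (\sum_j ln (y j 0)).

Definition grad (R : realType) (p : nat) (f : 'cV[R]_p -> R) (z : 'cV[R]_p) :
    'cV[R]_p :=
  \col_i 'D_(delta_mx i 0) f z.

Definition grad_phi (R : realType) (n m k : nat) (M : 'M[R]_(n, m)) (mu : R)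
    (x : 'cV[R]_(n * k)) (y : 'cV[R]_(m * k)) : 'cV[R]_(n * k + m * k) :=
  grad (fun z => phi M mu (usubmx z) (dsubmx z)) (col_mx x y).

(* H11, H21, H22 are the blocks of the symmetric upper left corner. *)
Definition kkt_matrix (R : realType) (n m k : nat) (H11 : 'M[R]_(n * k))
    (H21 : 'M[R]_(m * k, n * k)) (H22 : 'M[R]_(m * k)) (w : pd_point R n m k) :=
  block_mx
    (block_mx H11 H21^T H21 H22)              (block_mx (- 1%:M) 0 0 (- 1%:M))
    (block_mx (Diag (pr w)) 0 0 (Diag (ps w)))
                               (block_mx (Diag (px w)) 0 0 (Diag (py w))).

Definition kkt_rhs (R : realType) (n m k : nat) (M : 'M[R]_(n, m))
    (w : pd_point R n m k) (mu : R) :=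
  col_mx
    (col_mx (pr w - graX M (px w) (py w)) (ps w - graY M (px w) (py w)))
    (col_mx (mu *: ones R (n * k) - Diag (pr w) *m px w)
            (mu *: ones R (m * k) - Diag (ps w) *m py w)).

Definition primal_dual_direction (R : realType) (n m k : nat)
    (M : 'M[R]_(n, m)) (rho : R) (w : pd_point R n m k) (mu : R)
    (d : pd_point R n m k) : Prop :=
  kkt_matrix (Q1 n (py w) + rho%:M) (Cbar (px w) (py w))
             (Q2 m (px w) + rho%:M) w *m stack d
  = kkt_rhs M w mu.

Definition affine_direction (R : realType) (n m k : nat)
    (M : 'M[R]_(n, m)) (w : pd_point R n m k) (d : pd_point R n m k) : Prop :=
  kkt_matrix (Q1 n (py w)) (C M (px w) (py w)) (Q2 m (px w)) w *m stack d
  = kkt_rhs M w 0.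

Definition is_max (R : realType) (A : set R) (a : R) : Prop :=
  A a /\ ubound A a.

Definition boundary_step (R : realType) (p q : nat) (tau : R)
    (u du : 'cV[R]_p) (v dv : 'cV[R]_q) (alpha : R) : Prop :=
  is_max [set a | [/\ 0 < a, a <= 1,
                      mx_le ((1 - tau) *: u) (u + a *: du) &
                      mx_le ((1 - tau) *: v) (v + a *: dv)]] alpha.

Definition armijo (R : realType) (n m k : nat) (M : 'M[R]_(n, m)) (eta mu : R)
    (w d : pd_point R n m k) (alpha : R) : Prop :=
  phi M mu (px w + alpha *: px d) (py w + alpha *: py d)
  <= phi M mu (px w) (py w)
     + eta * alpha * inner (col_mx (px d) (py d)) (grad_phi M mu (px w) (py w)).

Definition inner_iteration (R : realType) (n m k : nat) (M : 'M[R]_(n, m))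
    (rho tau eta mu : R) (w w' : pd_point R n m k) : Prop :=
  exists (d : pd_point R n m k) (amax1 amax2 : R) (t : nat),
    let alpha t := 2^-1 ^+ t * amax1 in
    [/\ primal_dual_direction M rho w mu d,
        boundary_step tau (px w) (px d) (py w) (py d) amax1,
        boundary_step tau (pr w) (pr d) (ps w) (ps d) amax2,
        armijo M eta mu w d (alpha t)
        /\ (forall t', (t' < t)%N -> ~ armijo M eta mu w d (alpha t')) &
        w' = Point (px w + alpha t *: px d) (py w + alpha t *: py d)
                   (pr w + amax2 *: pr d) (ps w + amax2 *: ps d)].

Definition is_sigma (R : realType) (n m k : nat) (M : 'M[R]_(n, m))
    (w : pd_point R n m k) (sigma : R) : Prop :=
  exists (d : pd_point R n m k) (a1 a2 : R),
    let N := (n * k + m * k)%:R in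
    let mu_aff := (inner (px w + a1 *: px d) (pr w + a2 *: pr d)
                   + inner (py w + a1 *: py d) (ps w + a2 *: ps d)) / N in
    let mu_avg := (inner (px w) (pr w) + inner (py w) (ps w)) / N in
    [/\ affine_direction M w d,
        boundary_step 1 (px w) (px d) (py w) (py d) a1,
        boundary_step 1 (pr w) (pr d) (ps w) (ps d) a2 &
        sigma = Num.min ((mu_aff / mu_avg) ^+ 3) (99 / 100)].

(* The control point: about to evaluate the test of the outer, respectively
   the inner, loop.  Both loops test before executing their body. *)
Inductive location := OuterTest | InnerTest.

Record config (R : realType) (n m k : nat) := Config {
  loc : location;
  iterate : pd_point R n m k;
  barrier : R }.

Definition stopped (R : realType) (n m k : nat) (M : 'M[R]_(n, m))
    (eps_TOL : R) (c : config R n m k) : Prop :=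
  loc c = OuterTest /\ E M (iterate c) 0 <= eps_TOL.

Definition predictor_call (R : realType) (n m k : nat) (M : 'M[R]_(n, m))
    (eps : R -> R) (c : config R n m k) : Prop :=
  loc c = InnerTest /\ E M (iterate c) (barrier c) <= eps (barrier c).

Inductive ip_step (R : realType) (n m k : nat) (M : 'M[R]_(n, m))
    (rho tau eta eps_TOL : R) (eps : R -> R) :
    config R n m k -> config R n m k -> Prop :=
| step_enter (w : pd_point R n m k) (mu : R) :
    eps_TOL < E M w 0 ->
    ip_step M rho tau eta eps_TOL eps
      (Config OuterTest w mu) (Config InnerTest w mu)
| step_inner (w w' : pd_point R n m k) (mu : R) :
    eps mu < E M w mu ->
    inner_iteration M rho tau eta mu w w' ->
    ip_step M rho tau eta eps_TOL eps
      (Config InnerTest w mu) (Config InnerTest w' mu)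
| step_update (w : pd_point R n m k) (mu sigma : R) :
    E M w mu <= eps mu ->
    is_sigma M w sigma ->
    ip_step M rho tau eta eps_TOL eps
      (Config InnerTest w mu) (Config OuterTest w (sigma * mu)).

(* A maximal execution.  It stays put once no step is possible, which is the
   case when the outer test succeeds, but also whenever some quantity required
   by the next step does not exist; only the former counts as stopping. *)
Definition execution (R : realType) (n m k : nat) (M : 'M[R]_(n, m))
    (rho tau eta eps_TOL : R) (eps : R -> R)
    (w0 : pd_point R n m k) (mu0 : R) (c : nat -> config R n m k) : Prop :=
  c 0%N = Config OuterTest w0 mu0 /\
  forall N, ip_step M rho tau eta eps_TOL eps (c N) (c N.+1)
    \/ (~ (exists c', ip_step M rho tau eta eps_TOL eps (c N) c')
        /\ c N.+1 = c N).

Definition bounded_iterates (R : realType) (n m k : nat)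
    (c : nat -> config R n m k) : Prop :=
  exists B : R, forall N,
    [/\ l2norm (px (iterate (c N))) <= B, l2norm (py (iterate (c N))) <= B,
        l2norm (pr (iterate (c N))) <= B & l2norm (ps (iterate (c N))) <= B].

(* Main.v *)
Require Import Defs.
From mathcomp Require Import all_boot all_order all_algebra.
From mathcomp Require Import all_classical all_reals all_analysis.
From mathcomp Require Import ring lra.

Set Implicit Arguments.
Unset Strict Implicit.
Unset Printing Implicit Defensive.

Import Order.TTheory GRing.Theory Num.Theory.
Import numFieldNormedType.Exports.

Local Open Scope classical_set_scope.
Local Open Scope ring_scope.

(** Stack the variables as [z = (x, y)] and the multipliers as [w = (r, s)].
The proof is quantitative and extracts no convergent subsequence.

Fix the barrier parameter [mu > 0] and write [F] for the merit function and
[G] for its gradient, which is the gradient of the loss minus [mu / z].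
Eliminating the multiplier part [e] of the direction from the linear system
gives [(H + Diag(w/z)) d = - G], where [H] is the Gauss-Newton matrix
shifted by [rho].  Since [H] is the Gram matrix of the derivative of the
product [XY] plus [rho I], the direction exists and [rho |d|^2 <= - <d, G>]
([newton_exists], [newton_descent]).

Suppose that the inner loop runs forever with bounded iterates.
- [F] decreases and bounded sublevel sets of [F] stay away from the boundary
  of the orthant, so [z >= delta > 0] throughout ([sublevel_lower_bound]).
- Hence the directions are bounded, and [F] has a uniform quadratic upper
  model along them, so backtracking stops at a step bounded below, and each
  iteration decreases [F] by at least [c |d|^2] ([pd_update_decrease]).  As
  [F] is bounded below, [d] tends to 0.
- A full multiplier step lands on [w + e = (mu - w d) / z], which is close to
  [mu / z] once [d] is small.  It is then nonnegative, so the fraction to the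
  boundary rule accepts a step of at least [tau], and the distance from [w]
  to [mu / z] contracts by the factor [1 - tau] up to an error [O(|d|)]
  ([multiplier_contraction]).  Hence [w - mu / z] tends to 0.
- The reduced system gives [|G| = O(|d|)] ([newton_residual]), so both
  [grad f - w] and [z w - mu] tend to 0, that is, [E] tends to 0 and the
  inner test succeeds ([pd_iteration_converges], [inner_loop_reaches]).

Consequently an execution that never stops performs infinitely many barrier
updates, each of which multiplies [mu] by a factor at most 0.99
([barrier_decay]).  Both [mu] and its tolerance become arbitrarily small at
the end of the inner loops, and [E] at barrier parameter 0 is at most a
constant times the sum of [mu] and [E] at [mu] ([E_drop_barrier]), so the
outer test succeeds after all.  No execution gets stuck before that, since
every quantity an iteration needs exists ([ip_step_exists]). *)

(** * Norms, products and sequences *)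

Lemma l2norm_ge0 (R : realType) (p q : nat) (A : 'M[R]_(p, q)) : 0 <= l2norm A.
Proof. exact: sqrtr_ge0. Qed.

Lemma l2norm_sqr (R : realType) (p q : nat) (A : 'M[R]_(p, q)) :
  l2norm A ^+ 2 = \sum_i \sum_j A i j ^+ 2.
Proof.
by rewrite sqr_sqrtr//; do 2![apply: sumr_ge0 => ? _]; exact: sqr_ge0.
Qed.

Lemma l2norm_sqr_col (R : realType) (p : nat) (v : 'cV[R]_p) :
  l2norm v ^+ 2 = \sum_i v i 0 ^+ 2.
Proof. by rewrite l2norm_sqr; apply: eq_bigr => i _; rewrite big_ord1. Qed.

Lemma ler_l2norm_entry (R : realType) (p q : nat) (A : 'M[R]_(p, q)) i j :
  `|A i j| <= l2norm A.
Proof.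
rewrite -sqrtr_sqr ler_wsqrtr// (bigD1 i)//= (bigD1 j)//= -addrA lerDl.
apply: addr_ge0; first by apply: sumr_ge0 => ? _; exact: sqr_ge0.
by do 2![apply: sumr_ge0 => ? _]; exact: sqr_ge0.
Qed.

Lemma l2norm_le_entries (R : realType) (p : nat) (v : 'cV[R]_p) (e : R) :
  (forall i, `|v i 0| <= e) -> l2norm v <= p%:R * e.
Proof.
case: p v => [|p] v ve.
  rewrite mul0r /l2norm big1 ?sqrtr0//.
  by case.
have e0 : 0 <= e by exact: le_trans (ve ord0).
rewrite -(@ler_pXn2r _ 2)// ?nnegrE ?l2norm_ge0 ?mulr_ge0//.
rewrite l2norm_sqr_col; apply: (@le_trans _ _ (\sum_(i < p.+1) e ^+ 2)).
  by apply: ler_sum => i _; rewrite -real_normK ?num_real// lerXn2r ?nnegrE.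
rewrite sumr_const card_ord -[leLHS]mulr_natl exprMn ler_wpM2r ?sqr_ge0//.
by rewrite -natrX ler_nat leq_pmulr.
Qed.

Lemma l2norm_col_mx_sqr (R : realType) (p q : nat) (u : 'cV[R]_p)
    (v : 'cV[R]_q) :
  l2norm (col_mx u v) ^+ 2 = l2norm u ^+ 2 + l2norm v ^+ 2.
Proof.
rewrite !l2norm_sqr_col big_split_ord/=; congr (_ + _).
  by apply: eq_bigr => i _; rewrite col_mxEu.
by apply: eq_bigr => i _; rewrite col_mxEd.
Qed.

Lemma l2norm_col_mx_le (R : realType) (p q : nat) (u : 'cV[R]_p)
    (v : 'cV[R]_q) (a : R) :
  l2norm u <= a -> l2norm v <= a -> l2norm (col_mx u v) <= a *+ 2.
Proof.
move=> ua va; have u0 := l2norm_ge0 u; have v0 := l2norm_ge0 v.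
have a0 : 0 <= a by exact: le_trans ua.
rewrite -(@ler_pXn2r _ 2)// ?nnegrE ?l2norm_ge0 ?mulrn_wge0//.
rewrite l2norm_col_mx_sqr; nra.
Qed.

Lemma innerE (R : realType) (p : nat) (u v : 'cV[R]_p) :
  inner u v = \sum_i u i 0 * v i 0.
Proof. by rewrite /inner mxE; apply: eq_bigr => i _; rewrite mxE. Qed.

Lemma inner_self (R : realType) (p : nat) (v : 'cV[R]_p) :
  inner v v = l2norm v ^+ 2.
Proof. by rewrite innerE l2norm_sqr_col; apply: eq_bigr. Qed.

Lemma ler_norm_sum_ord (R : realType) (p : nat) (F : 'I_p -> R) (c : R) :
  (forall i, `|F i| <= c) -> `|\sum_i F i| <= p%:R * c.
Proof.
move=> Fc; apply: le_trans (ler_norm_sum _ _ _) _.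
apply: (@le_trans _ _ (\sum_(i < p) c)); first by apply: ler_sum => i _.
by rewrite sumr_const card_ord mulr_natl.
Qed.

Lemma inner_le_entries (R : realType) (p : nat) (u v : 'cV[R]_p) (b : R) :
  (forall i, `|v i 0| <= b) -> `|inner u v| <= p%:R * (l2norm u * b).
Proof.
move=> vb; rewrite innerE; apply: ler_norm_sum_ord => i.
by rewrite normrM ler_pM// ler_l2norm_entry.
Qed.

Lemma inner_delta_mx (R : realType) (p : nat) (v : 'cV[R]_p) (i : 'I_p) :
  inner (delta_mx i 0) v = v i 0.
Proof.
rewrite innerE (bigD1 i)//= big1 => [|j ji]; rewrite mxE ?eqxx ?(negbTE ji).
  by rewrite mul1r addr0.
by rewrite mul0r.
Qed.

Lemma lower_bound_pos (R : realType) (p : nat) (z : 'cV[R]_p) :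
  mx_pos z -> exists2 delta, 0 < delta & forall i, delta <= z i 0.
Proof.
move=> z0; exists (\big[Num.min/1]_i z i 0).
  by apply: lt_bigmin.
by move=> i; exact: bigmin_le_cond.
Qed.

Lemma ler_mulmx_entry (R : realType) (p q r : nat) (A : 'M[R]_(p, q))
    (B : 'M[R]_(q, r)) (a b : R) i j :
  (forall i l, `|A i l| <= a) -> (forall l j, `|B l j| <= b) ->
  `|(A *m B) i j| <= q%:R * (a * b).
Proof.
move=> Aa Bb; rewrite mxE; apply: ler_norm_sum_ord => l.
by rewrite normrM ler_pM.
Qed.

Lemma mx_pos_col (R : realType) (p q : nat) (u : 'cV[R]_p) (v : 'cV[R]_q) :
  mx_pos (col_mx u v) <-> mx_pos u /\ mx_pos v.
Proof.
split=> [uv|[u0 v0] i j].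
  split=> i j; first by have := uv (lshift q i) j; rewrite col_mxEu.
  by have := uv (rshift p i) j; rewrite col_mxEd.
by case: (split_ordP i) => l ->; rewrite ?col_mxEu ?col_mxEd.
Qed.

Lemma Diag_mul (R : realType) (p : nat) (u v : 'cV[R]_p) i :
  (Diag u *m v) i 0 = u i 0 * v i 0.
Proof. by rewrite mul_diag_mx !mxE. Qed.

(** Used to see that backtracking reaches arbitrarily short steps. *)
Lemma exists_small_halving (R : realType) (x e : R) :
  0 <= x -> 0 < e -> exists t, x * 2^-1 ^+ t <= e.
Proof.
move=> x0 e0; exists (Num.bound (x / e)).
set t := Num.bound _.
rewrite exprVn ler_pdivrMr ?exprn_gt0// -ler_pdivrMl// mulrC.
have /ltW/le_trans : x / e < t%:R.
  by apply: archi_boundP; rewrite divr_ge0// ltW.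
apply; rewrite -natrX ler_nat; exact/ltnW/ltn_expl.
Qed.

(** Past an index where [v] is at most [(1 - q) e / 2], iterating the recursion
bounds [u] by a geometric term plus the fixed point [e / 2] of the
resulting affine map. *)
Lemma contraction_to0 (R : realType) (q : R) (u v : nat -> R) :
  0 <= q < 1 -> (forall N, 0 <= u N) -> v @ \oo --> 0 ->
  (\forall N \near \oo, u N.+1 <= q * u N + v N) -> u @ \oo --> 0.
Proof.
move=> /andP[q0 q1] u0 v0 [N1 _ uq].
apply/cvgrPdist_le => e e0.
have q10 : 0 < 1 - q by rewrite subr_gt0.
have e2 : 0 < (1 - q) * (e / 2) by rewrite mulr_gt0// divr_gt0.
have /cvgrPdist_le/(_ _ e2)[N2 _ vN2] := v0.
pose N0 := maxn N1 N2.
have uN j : u (N0 + j)%N <= q ^+ j * u N0 + e / 2.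
  elim: j => [|j IH]; first by rewrite addn0 expr0 mul1r lerDl divr_ge0// ltW.
  have N1le : (N1 <= N0 + j)%N.
    exact: leq_trans (leq_maxl N1 N2) (leq_addr _ _).
  have N2le : (N2 <= N0 + j)%N.
    exact: leq_trans (leq_maxr N1 N2) (leq_addr _ _).
  rewrite addnS; apply: le_trans (uq _ N1le) _.
  have : v (N0 + j)%N <= (1 - q) * (e / 2).
    apply: le_trans (ler_norm _) _.
    by have := vN2 _ N2le; rewrite sub0r normrN.
  have : q * u (N0 + j)%N <= q * (q ^+ j * u N0 + e / 2) by rewrite ler_wpM2l.
  by rewrite exprS; lra.
have /cvgrPdist_le : geometric (u N0) q @ \oo --> 0.
  by apply: cvg_geometric; rewrite ger0_norm.
have e20 : 0 < e / 2 by rewrite divr_gt0.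
move=> /(_ _ e20)[N3 _ qN3].
exists (N0 + N3)%N => // N /= N0N; rewrite sub0r normrN ger0_norm//.
have N0le : (N0 <= N)%N by exact: (leq_trans (leq_addr N3 N0) N0N).
rewrite -(subnKC N0le); apply: le_trans (uN _) _.
have N3N : (N3 <= N - N0)%N by rewrite leq_subRL.
have := qN3 _ N3N; rewrite /= sub0r normrN => /(le_trans (ler_norm _)).
by rewrite mulrC; lra.
Qed.

(** * Logarithmic barrier functions *)

(** The upper bound is [ln (1 + u) <= u]; the lower one is the same inequality
at the reciprocal, which gives [u / (1 + u) <= ln (1 + u)]. *)
Lemma ln1D_quadratic (R : realType) (c u : R) :
  0 < c -> c <= 1 + u -> `|ln (1 + u) - u| <= u ^+ 2 / c.
Proof.
move=> c0 cu; have u0 : 0 < 1 + u by exact: lt_le_trans cu.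
have lu : ln (1 + u) <= u by apply: le_ln1Dx; lra.
have ul : u / (1 + u) <= ln (1 + u).
  rewrite -[X in ln X]invrK lnV ?posrE ?invr_gt0// lerNr.
  have invE : (1 + u)^-1 = 1 + - (u / (1 + u)) by field; rewrite gt_eqF.
  rewrite [X in ln X]invE; apply: le_ln1Dx.
  rewrite ltrN2 ltr_pdivrMr// mul1r; lra.
rewrite ler0_norm ?subr_le0// opprB lerBlDr.
apply: (@le_trans _ _ (u ^+ 2 / (1 + u) + u / (1 + u))).
  by rewrite le_eqVlt; apply/orP; left; apply/eqP; field; rewrite gt_eqF.
by rewrite lerD// ler_wpM2l ?sqr_ge0// lef_pV2 ?posrE.
Qed.

Lemma ln_quadratic (R : realType) (c z d : R) :
  0 < c -> 0 < z -> c * z <= z + d ->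
  `|ln (z + d) - ln z - d / z| <= (d / z) ^+ 2 / c.
Proof.
move=> c0 z0 cz.
have zd : z + d = z * (1 + d / z) by field; rewrite gt_eqF.
have cu : c <= 1 + d / z by rewrite -(ler_pM2l z0) -zd mulrC.
rewrite zd lnM ?posrE//; last exact: lt_le_trans cu.
by rewrite [ln z + _]addrC addrK; exact: ln1D_quadratic.
Qed.

Definition barrier_fun (R : realType) (p : nat) (f : 'cV[R]_p -> R) (mu : R)
    (z : 'cV[R]_p) : R :=
  f z - mu * \sum_i ln (z i 0).

Definition barrier_grad (R : realType) (p : nat)
    (g : 'cV[R]_p -> 'cV[R]_p) (mu : R) (z : 'cV[R]_p) : 'cV[R]_p :=
  \col_i (g z i 0 - mu / z i 0).

(** A form of local Lipschitz continuity of the gradient that needs no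
differentiation: [g] is the gradient of [f] with a quadratic error which is
uniform on balls. *)
Definition quadratic_model (R : realType) (p : nat) (f : 'cV[R]_p -> R)
    (g : 'cV[R]_p -> 'cV[R]_p) : Prop :=
  forall B, exists2 L, 0 <= L & forall z d h,
    l2norm z <= B -> l2norm d <= B -> `|h| <= 1 ->
    `|f (z + h *: d) - f z - h * inner d (g z)| <= L * (h * l2norm d) ^+ 2.

Lemma inner_barrier_grad (R : realType) (p : nat) (g : 'cV[R]_p -> 'cV[R]_p)
    (mu : R) (z d : 'cV[R]_p) :
  inner d (barrier_grad g mu z)
  = inner d (g z) - mu * \sum_i d i 0 / z i 0.
Proof.
rewrite !innerE mulr_sumr -sumrB; apply: eq_bigr => i _.
by rewrite mxE; ring.
Qed.

(** Relative to [z], the fraction to the boundary condition keeps the argument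
of each logarithm at least [c], which is what makes the second order error
of the barrier term uniform. *)
Lemma barrier_quadratic (R : realType) (p : nat) (f : 'cV[R]_p -> R)
    (g : 'cV[R]_p -> 'cV[R]_p) (mu L c delta h : R) (z d : 'cV[R]_p) :
  0 < mu -> 0 < c -> 0 < delta ->
  (forall i, delta <= z i 0) -> mx_le (c *: z) (z + h *: d) ->
  `|f (z + h *: d) - f z - h * inner d (g z)| <= L * (h * l2norm d) ^+ 2 ->
  `|barrier_fun f mu (z + h *: d) - barrier_fun f mu z
    - h * inner d (barrier_grad g mu z)|
  <= (L + mu / (c * delta ^+ 2)) * (h * l2norm d) ^+ 2.
Proof.
move=> mu0 c0 delta0 zdelta zc fL.
have z0 i : 0 < z i 0 by exact: lt_le_trans (zdelta i).
rewrite inner_barrier_grad /barrier_fun.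
set F := f (z + _) - _ - _ in fL *.
set S := \sum_i (ln ((z + h *: d) i 0) - ln (z i 0) - h * d i 0 / z i 0).
have -> : f (z + h *: d) - mu * (\sum_i ln ((z + h *: d) i 0))
    - (f z - mu * (\sum_i ln (z i 0)))
    - h * (inner d (g z) - mu * (\sum_i d i 0 / z i 0)) = F - mu * S.
  rewrite /S !sumrB.
  under [X in _ - mu * (_ - X)]eq_bigr do rewrite -mulrA.
  by rewrite -mulr_sumr /F; ring.
apply: le_trans (ler_normB _ _) _; rewrite mulrDl lerD//.
rewrite normrM (gtr0_norm mu0) -mulrA ler_pM2l//.
apply: le_trans (ler_norm_sum _ _ _) _.
rewrite exprMn l2norm_sqr_col !mulr_sumr; apply: ler_sum => i _.
have := @ln_quadratic _ c (z i 0) (h * d i 0) c0 (z0 i).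
have := zc i 0; rewrite !mxE => zci /(_ zci) /le_trans; apply.
rewrite exprMn exprVn exprMn [(c * _)^-1]invfM.
have -> : (h ^+ 2 * d i 0 ^+ 2 / z i 0 ^+ 2 / c)
  = c^-1 * (z i 0 ^+ 2)^-1 * (h ^+ 2 * d i 0 ^+ 2) by ring.
rewrite ler_wpM2r//; first by rewrite -exprMn sqr_ge0.
rewrite ler_wpM2l ?invr_ge0 ?(ltW c0)//.
rewrite lef_pV2 ?posrE ?exprn_gt0// lerXn2r ?nnegrE//; exact: ltW.
Qed.

(** Along a coordinate axis the quadratic model bounds the difference quotient
minus its limit by a multiple of [|h|]. *)
Lemma grad_barrier (R : realType) (p : nat) (f : 'cV[R]_p -> R)
    (g : 'cV[R]_p -> 'cV[R]_p) (mu : R) (z : 'cV[R]_p) :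
  quadratic_model f g -> 0 < mu -> mx_pos z ->
  grad (barrier_fun f mu) z = barrier_grad g mu z.
Proof.
move=> fg mu0 z0; apply/matrixP => i j; rewrite ord1 mxE {j}.
have [delta delta0 zdelta] := lower_bound_pos z0.
set v : 'cV[R]_p := delta_mx i 0.
have [L L0 fL] := fg (Num.max (l2norm z) (l2norm v)).
set K := (L + mu / (2^-1 * delta ^+ 2)) * l2norm v ^+ 2.
have K0 : 0 <= K.
  rewrite mulr_ge0 ?sqr_ge0// addr_ge0// divr_ge0 ?ltW//.
  by rewrite mulr_gt0// exprn_gt0.
apply: cvg_lim => //; apply/cvgrPdist_le => e e0.
(* The three bounds make the quadratic model applicable, keep z + h v at
   least z / 2, and make the error K |h| at most e. *)
pose r := Num.min (Num.min 1 (2^-1 * delta)) (e / (K + 1)).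
have r0 : 0 < r.
  by rewrite !lt_min ltr01 mulr_gt0//= divr_gt0// ltr_wpDl.
near=> h.
have hr : `|h| <= r by near: h; exact: dnbhs0_le.
have h0 : h != 0 by near: h; exact: nbhs_dnbhs_neq.
move: hr; rewrite !le_min => /andP[/andP[h1 hdelta] hK].
have := @barrier_quadratic _ p f g mu L 2^-1 delta h z v mu0 _ delta0 zdelta.
rewrite !inner_delta_mx.
have -> : (barrier_grad g mu z i 0 - h^-1 *:
    ((barrier_fun f mu \o shift z) (h *: v) - barrier_fun f mu z))
  = - (h^-1 * (barrier_fun f mu (z + h *: v) - barrier_fun f mu z
        - h * barrier_grad g mu z i 0)).
  rewrite /= [h *: v + z]addrC.
  have scaleE (x : R) : h^-1 *: x = h^-1 * x by [].
  by rewrite scaleE [in RHS]mulrBr mulKf// [RHS]opprB.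
have half0 : 0 < 2^-1 :> R by rewrite invr_gt0.
rewrite normrN normrM => H; apply: (@le_trans _ _ (`|h^-1| * (K * `|h| ^+ 2))).
  rewrite ler_wpM2l//; apply: le_trans (H half0 _ _) _.
  - move=> j l; rewrite ord1 !mxE.
    have hd : `|h * ((j == i) && (0 == 0 :> 'I_1))%:R| <= 2^-1 * z j 0.
      rewrite normrM; apply: (@le_trans _ _ (2^-1 * delta)); last first.
        by rewrite ler_wpM2l// ltW.
      apply: le_trans hdelta; rewrite -[leRHS]mulr1 ler_wpM2l//.
      by rewrite normr_nat; case: (_ && _).
    by move: hd; rewrite ler_norml => /andP[? ?]; lra.
  - rewrite -(inner_delta_mx (g z)); apply: fL => //.
      by rewrite le_max lexx.
    by rewrite le_max lexx orbT.
  - by rewrite /K exprMn real_normK ?num_real// -mulrA [h ^+ 2 * _]mulrC.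
have -> : `|h^-1| * (K * `|h| ^+ 2) = K * `|h|.
  by rewrite normfV; field; rewrite normr_eq0.
apply: (@le_trans _ _ (K * (e / (K + 1)))); first by rewrite ler_wpM2l.
rewrite mulrA ler_pdivrMr ?ltr_wpDl//; nra.
Unshelve. all: by end_near.
Qed.

(** * The regularized Newton direction *)

(** The system that determines the primal part [d] and the multiplier part [e]
of the direction, with the complementarity rows written entrywise. *)
Definition newton_eqs (R : realType) (p : nat) (H : 'M[R]_p)
    (gz z w : 'cV[R]_p) (mu : R) (d e : 'cV[R]_p) : Prop :=
  H *m d - e = w - gz /\
  forall i, w i 0 * d i 0 + z i 0 * e i 0 = mu - w i 0 * z i 0.

(** Solving the complementarity rows for [e] and substituting leaves a system in
[d] alone whose right hand side is minus the barrier gradient. *)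
Lemma newton_eliminated (R : realType) (p : nat) (H : 'M[R]_p)
    (g : 'cV[R]_p -> 'cV[R]_p) (z w : 'cV[R]_p) (mu : R) (d e : 'cV[R]_p) i :
  mx_pos z -> newton_eqs H (g z) z w mu d e ->
  (H *m d) i 0 + w i 0 / z i 0 * d i 0 = - barrier_grad g mu z i 0.
Proof.
move=> z0 [/matrixP/(_ i 0)]; rewrite !mxE => Hd /(_ i) we.
have zi : z i 0 != 0 by rewrite gt_eqF.
have -> : \sum_j H i j * d j 0 = w i 0 - g z i 0 + e i 0 by rewrite -Hd subrK.
have -> : e i 0 = (mu - w i 0 * z i 0 - w i 0 * d i 0) / z i 0.
  by rewrite -we addrC addKr mulrC mulKf.
by field.
Qed.

(** Pair the reduced system with [d]; the diagonal [w / z] only adds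
nonnegative terms. *)
Lemma newton_descent (R : realType) (p : nat) (H : 'M[R]_p)
    (g : 'cV[R]_p -> 'cV[R]_p) (z w : 'cV[R]_p) (rho mu : R) (d e : 'cV[R]_p) :
  (forall v, rho * l2norm v ^+ 2 <= inner v (H *m v)) ->
  mx_pos z -> mx_pos w -> newton_eqs H (g z) z w mu d e ->
  rho * l2norm d ^+ 2 <= - inner d (barrier_grad g mu z).
Proof.
move=> Hrho z0 w0 nd; apply: le_trans (Hrho d) _.
rewrite !innerE -sumrN; apply: ler_sum => i _.
rewrite -mulrN -(newton_eliminated i z0 nd) mulrDr lerDl.
by rewrite mulrCA -expr2 mulr_ge0 ?sqr_ge0// divr_ge0 ?ltW.
Qed.

(** The reduced matrix [H + Diag(w/z)] is invertible because it is positive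
definite, so a vector annihilated by it vanishes. *)
Lemma newton_exists (R : realType) (p : nat) (H : 'M[R]_p)
    (g : 'cV[R]_p -> 'cV[R]_p) (z w : 'cV[R]_p) (rho mu : R) :
  0 < rho -> (forall v, rho * l2norm v ^+ 2 <= inner v (H *m v)) ->
  mx_pos z -> mx_pos w -> exists d e, newton_eqs H (g z) z w mu d e.
Proof.
move=> rho0 Hrho z0 w0.
pose S := diag_mx (\row_i (w i 0 / z i 0)).
have SE (v : 'cV[R]_p) i : (S *m v) i 0 = w i 0 / z i 0 * v i 0.
  by rewrite mul_diag_mx !mxE.
have Hunit : H + S \in unitmx.
  rewrite unitmxE unitfE; apply/negP => /det0P[u u0 uHS].
  have : inner u^T ((H + S) *m u^T) = 0.
    by rewrite /inner trmxK mulmxA uHS mul0mx mxE.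
  move/eqP; apply/negP; rewrite gt_eqF// mulmxDl.
  have -> : inner u^T (H *m u^T + S *m u^T)
    = inner u^T (H *m u^T) + inner u^T (S *m u^T).
    by rewrite /inner mulmxDr mxE.
  rewrite ltr_wpDr//.
    rewrite innerE; apply: sumr_ge0 => i _; rewrite SE mulrCA -expr2.
    by rewrite mulr_ge0 ?sqr_ge0// divr_ge0 ?ltW.
  apply: lt_le_trans (Hrho _); rewrite mulr_gt0// exprn_gt0//.
  rewrite lt_neqAle l2norm_ge0 andbT eq_sym; apply: contraNneq u0 => u0.
  apply/eqP/matrixP => a i; rewrite ord1 [RHS]mxE; apply/eqP.
  rewrite -normr_le0 -u0; have := ler_l2norm_entry u^T i 0.
  by rewrite mxE.
have [d dE] : exists d, H *m d + S *m d = - barrier_grad g mu z.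
  exists (invmx (H + S) *m - barrier_grad g mu z).
  by rewrite -mulmxDl mulKVmx.
exists d, (\col_i ((mu - w i 0 * z i 0 - w i 0 * d i 0) / z i 0)); split.
  move: (H *m d) dE => q dE; apply/matrixP => i j; rewrite ord1 {j}.
  have zi : z i 0 != 0 by rewrite gt_eqF.
  have := congr1 (fun v : 'cV[R]_p => v i 0) dE.
  rewrite /= [LHS]mxE SE !mxE => qE.
  by rewrite -(addrK (w i 0 / z i 0 * d i 0) (q i 0)) qE; field.
move=> i; rewrite mxE.
have zi : z i 0 != 0 by rewrite gt_eqF.
by field.
Qed.

(** * Step lengths *)

(** The fraction to the boundary rule on a single stacked vector. *)
Definition max_step (R : realType) (p : nat) (tau : R) (z d : 'cV[R]_p)
    (a : R) : Prop :=
  is_max [set a | [/\ 0 < a, a <= 1 & mx_le ((1 - tau) *: z) (z + a *: d)]] a.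

(** Only the coordinates that decrease restrict the step, each to at most
[tau * z / - d]; the minimum of 1 and these ratios is the maximal step. *)
Lemma max_step_exists (R : realType) (p : nat) (tau : R) (z d : 'cV[R]_p) :
  0 < tau -> mx_pos z -> exists a, max_step tau z d a.
Proof.
move=> tau0 z0.
pose a := \big[Num.min/1]_(i | d i 0 < 0) (tau * z i 0 / - d i 0).
have a0 : 0 < a.
  by apply: lt_bigmin => // i di; rewrite divr_gt0 ?mulr_gt0 ?oppr_gt0.
have stepE b i : d i 0 < 0 ->
    ((1 - tau) * z i 0 <= z i 0 + b * d i 0) = (b <= tau * z i 0 / - d i 0).
  move=> di; rewrite ler_pdivlMr ?oppr_gt0// mulrN.
  by apply/idP/idP => ?; lra.
exists a; split=> [|b [b0 b1 bz]].
  split=> //; first exact: bigmin_le_id.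
  move=> i j; rewrite ord1 !mxE; have [di|di] := ltP (d i 0) 0.
    by rewrite stepE//; exact: bigmin_le_cond.
  apply: (@le_trans _ _ (z i 0)); first by have := z0 i 0; nra.
  by rewrite lerDl mulr_ge0// ltW.
apply: le_bigmin => // i di; rewrite -stepE//.
by have := bz i 0; rewrite !mxE.
Qed.

Lemma max_step_shorten (R : realType) (p : nat) (tau a b : R)
    (z d : 'cV[R]_p) :
  0 < tau -> mx_pos z -> max_step tau z d b -> 0 <= a <= b ->
  mx_le ((1 - tau) *: z) (z + a *: d).
Proof.
move=> tau0 z0 [[b0 b1 bz] _] /andP[a0 ab] i j; rewrite ord1.
move: (bz i 0) (z0 i 0); rewrite !mxE => {}bz zi.
have [di|di] := ltP (d i 0) 0; last by nra.
by apply: le_trans bz _; rewrite lerD2l ler_wnM2r// ltW.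
Qed.

Lemma boundary_stepE (R : realType) (p q : nat) (tau : R)
    (u du : 'cV[R]_p) (v dv : 'cV[R]_q) (a : R) :
  boundary_step tau u du v dv a
  = max_step tau (col_mx u v) (col_mx du dv) a.
Proof.
rewrite /boundary_step /max_step; congr is_max; apply/funext => b.
apply/propext; split=> [[b0 b1 bu bv]|[b0 b1 buv]]; split=> //.
- move=> i j; rewrite ord1 !scale_col_mx add_col_mx.
  by case: (split_ordP i) => l ->; rewrite ?col_mxEu ?col_mxEd.
- move=> i j; rewrite ord1; have := buv (lshift q i) 0.
  by rewrite !scale_col_mx add_col_mx !col_mxEu.
- move=> i j; rewrite ord1; have := buv (rshift p i) 0.
  by rewrite !scale_col_mx add_col_mx !col_mxEd.
Qed.

Definition sufficient_decrease (R : realType) (p : nat) (F : 'cV[R]_p -> R)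
    (eta slope : R) (z d : 'cV[R]_p) (a : R) : Prop :=
  F (z + a *: d) <= F z + eta * a * slope.

(** The quadratic error [K a^2 |d|^2] is absorbed by the fraction [1 - eta] of
the predicted decrease, which is at least [a rho |d|^2]. *)
Lemma short_step_decrease (R : realType) (p : nat) (F : 'cV[R]_p -> R)
    (rho eta K slope a : R) (z d : 'cV[R]_p) :
  eta < 1 -> 0 <= a ->
  rho * l2norm d ^+ 2 <= - slope -> K * a <= (1 - eta) * rho ->
  `|F (z + a *: d) - F z - a * slope| <= K * (a * l2norm d) ^+ 2 ->
  sufficient_decrease F eta slope z d a.
Proof.
move=> eta1 a0 ds Ka; rewrite ler_norml => /andP[_ FK].
rewrite /sufficient_decrease.
have KaD : K * a * l2norm d ^+ 2 <= (1 - eta) * - slope.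
  apply: (@le_trans _ _ ((1 - eta) * rho * l2norm d ^+ 2)).
    by rewrite ler_wpM2r// sqr_ge0.
  by rewrite -mulrA ler_wpM2l// subr_ge0 ltW.
have : a * (K * a * l2norm d ^+ 2) <= a * ((1 - eta) * - slope).
  by rewrite ler_wpM2l.
by move: FK; rewrite exprMn; lra.
Qed.

(** * Convergence of the primal-dual iteration for a fixed barrier parameter *)

Definition bounded_on_balls (R : realType) (p : nat)
    (g : 'cV[R]_p -> 'cV[R]_p) : Prop :=
  forall B, exists2 G : R, 0 <= G &
    forall z, l2norm z <= B -> forall i, `|g z i 0| <= G.

Definition operator_bounded_on_balls (R : realType) (p : nat)
    (H : 'cV[R]_p -> 'M[R]_p) : Prop :=
  forall B, exists2 Lam : R, 0 <= Lam &
    forall z (v : 'cV[R]_p), l2norm z <= B ->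
      forall i, `|(H z *m v) i 0| <= Lam * l2norm v.

Definition coercive (R : realType) (p : nat) (rho : R)
    (H : 'cV[R]_p -> 'M[R]_p) : Prop :=
  forall z (v : 'cV[R]_p), rho * l2norm v ^+ 2 <= inner v (H z *m v).

Section PrimalDualIteration.
Context (R : realType) (p : nat) (f : 'cV[R]_p -> R)
  (g : 'cV[R]_p -> 'cV[R]_p) (H : 'cV[R]_p -> 'M[R]_p) (rho tau eta mu : R).
Hypotheses (rho_gt0 : 0 < rho) (tau_gt0 : 0 < tau) (tau_lt1 : tau < 1)
  (eta_gt0 : 0 < eta) (eta_lt1 : eta < 1) (mu_gt0 : 0 < mu).
Hypotheses (f_ge0 : forall z, 0 <= f z) (fg : quadratic_model f g)
  (g_bounded : bounded_on_balls g) (H_bounded : operator_bounded_on_balls H)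
  (H_coercive : coercive rho H).

Let F := barrier_fun f mu.
Let G := barrier_grad g mu.

(** One inner iteration, with the two step lengths chosen by the fraction to the
boundary rule and by backtracking, on stacked vectors. *)
Definition pd_update (z w z' w' : 'cV[R]_p) : Prop :=
  exists (d e : 'cV[R]_p) (amax1 amax2 : R) (t : nat),
    let decrease t :=
      sufficient_decrease F eta (inner d (G z)) z d (2^-1 ^+ t * amax1) in
    [/\ newton_eqs (H z) (g z) z w mu d e,
        max_step tau z d amax1,
        max_step tau w e amax2,
        decrease t /\ (forall t', (t' < t)%N -> ~ decrease t') &
        z' = z + (2^-1 ^+ t * amax1) *: d /\ w' = w + amax2 *: e].

Let halving_ge0 t : 0 <= 2^-1 ^+ t :> R.
Proof. by rewrite exprn_ge0// invr_ge0. Qed.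

Let halving_le1 t : 2^-1 ^+ t <= 1 :> R.
Proof. by rewrite exprn_ile1// ?invr_ge0// invf_le1// ler1n. Qed.

Lemma halved_step_in (amax : R) (t : nat) :
  0 <= amax -> 0 <= 2^-1 ^+ t * amax <= amax.
Proof.
by move=> a0; rewrite mulr_ge0//= -[leRHS]mul1r ler_wpM2r.
Qed.

Lemma pd_update_pos (z w z' w' : 'cV[R]_p) :
  mx_pos z -> mx_pos w -> pd_update z w z' w' -> mx_pos z' /\ mx_pos w'.
Proof.
move=> z0 w0 [d [e [a1 [a2 [t [_ m1 m2 _ [-> ->]]]]]]].
have a10 : 0 <= a1 by case: m1 => [[/ltW]].
have a20 : 0 <= a2 by case: m2 => [[/ltW]].
have tau1 : 0 < 1 - tau by rewrite subr_gt0.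
split=> i j; rewrite ord1.
  have := max_step_shorten tau_gt0 z0 m1 (halved_step_in t a10) i 0.
  by apply: lt_le_trans; rewrite mxE mulr_gt0.
have := @max_step_shorten _ _ tau a2 a2 _ _ tau_gt0 w0 m2.
rewrite a20 lexx => /(_ isT i 0).
by apply: lt_le_trans; rewrite mxE mulr_gt0.
Qed.

(** The boundary rule keeps [z + a d] where the quadratic model of the barrier
function holds, and a step shorter than [(1 - eta) rho / K], with [K] the
constant of that model, then decreases [F] sufficiently. *)
Lemma backtracking_succeeds (L delta a amax : R) (z w d e : 'cV[R]_p) :
  0 < delta -> (forall i, delta <= z i 0) -> mx_pos w ->
  newton_eqs (H z) (g z) z w mu d e -> max_step tau z d amax ->
  0 <= a <= amax ->
  `|f (z + a *: d) - f z - a * inner d (g z)| <= L * (a * l2norm d) ^+ 2 ->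
  (L + mu / ((1 - tau) * delta ^+ 2)) * a <= (1 - eta) * rho ->
  sufficient_decrease F eta (inner d (G z)) z d a.
Proof.
move=> delta0 zdelta w0 nd m aa fL Ka.
have z0 : mx_pos z by move=> i j; rewrite ord1; exact: lt_le_trans (zdelta i).
have tau1 : 0 < 1 - tau by rewrite subr_gt0.
apply: (short_step_decrease eta_lt1 _ _ Ka); first by case/andP: aa.
  exact: newton_descent (H_coercive z) z0 w0 nd.
apply: barrier_quadratic => //.
exact: max_step_shorten m aa.
Qed.

(** The threshold of [backtracking_succeeds] is positive, so repeated halving
falls below it. *)
Lemma pd_update_exists (z w : 'cV[R]_p) :
  mx_pos z -> mx_pos w -> exists z' w', pd_update z w z' w'.
Proof.
move=> z0 w0.
have [d [e nd]] := newton_exists g mu rho_gt0 (H_coercive z) z0 w0.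
have [a1 m1] := max_step_exists d tau_gt0 z0.
have [a2 m2] := max_step_exists e tau_gt0 w0.
have [delta delta0 zdelta] := lower_bound_pos z0.
have [L L0 fL] := fg (Num.max (l2norm z) (l2norm d)).
have tau1 : 0 < 1 - tau by rewrite subr_gt0.
set K := L + mu / ((1 - tau) * delta ^+ 2).
have K0 : 0 <= K.
  by rewrite addr_ge0// divr_ge0 ?ltW// mulr_gt0// exprn_gt0.
have er0 : 0 < (1 - eta) * rho by rewrite mulr_gt0// subr_gt0.
have a10 : 0 < a1 by case: m1 => [[]].
have a11 : a1 <= 1 by case: m1 => [[]].
have [t0 Kt0] := exists_small_halving K0 er0.
pose dec t :=
  `[< sufficient_decrease F eta (inner d (G z)) z d (2^-1 ^+ t * a1) >].
have /ex_minnP[t /asboolP dect tmin] : exists t, dec t.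
  exists t0; apply/asboolP.
  have /andP[h0 h1] := halved_step_in t0 (ltW a10).
  apply: (backtracking_succeeds delta0 zdelta w0 nd m1) => //.
  - exact: halved_step_in (ltW a10).
  - apply: fL; rewrite ?le_max ?lexx ?orbT//.
    by rewrite ger0_norm//; exact: le_trans a11.
  - apply: le_trans Kt0; rewrite ler_wpM2l//.
    by rewrite -[leRHS]mulr1 ler_wpM2l.
exists (z + (2^-1 ^+ t * a1) *: d), (w + a2 *: e), d, e, a1, a2, t.
split=> //; split=> // t' t't /asboolP/tmin.
by rewrite leqNgt t't.
Qed.

(** The loss is nonnegative and [ln z_j <= B] for each [j], so a bound on
the barrier function bounds each single [- ln z_i] from above. *)
Lemma sublevel_lower_bound (B Phi : R) :
  exists2 delta, 0 < delta & forall z : 'cV[R]_p, mx_pos z ->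
    l2norm z <= B -> F z <= Phi -> forall i, delta <= z i 0.
Proof.
exists (expR (- (Phi / mu + p%:R * B))); first exact: expR_gt0.
move=> z z0 zB FPhi i.
rewrite -[leRHS]lnK ?posrE// ler_expR lerNl.
have lnB j : ln (z j 0) <= B.
  apply: le_trans (ltW (ln_sublinear (z0 j 0))) _.
  by apply: le_trans (ler_norm _) (le_trans (ler_l2norm_entry z j 0) zB).
have B0 : 0 <= B by exact: le_trans (l2norm_ge0 z) zB.
have others : \sum_(j | j != i) ln (z j 0) <= p%:R * B.
  apply: (@le_trans _ _ (\sum_(j < p) B)).
    rewrite [leRHS](bigD1 i)//= -[leLHS]add0r lerD//.
    by apply: ler_sum => j _.
  by rewrite sumr_const card_ord mulr_natl.
move: FPhi; rewrite /F /barrier_fun (bigD1 i)//= => FPhi.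
have f0 := f_ge0 z.
rewrite -lerBlDr ler_pdivlMr//.
have : mu * (\sum_(j | j != i) ln (z j 0)) <= mu * (p%:R * B).
  by rewrite ler_pM2l.
lra.
Qed.

(** [rho |d|^2 <= - <d, G> = O(|d|)], because [G] is bounded where [z] is
bounded and stays away from 0. *)
Lemma newton_direction_bound (B delta : R) :
  0 < delta -> exists2 D0, 0 <= D0 & forall z w d e : 'cV[R]_p,
    (forall i, delta <= z i 0) -> mx_pos w -> l2norm z <= B ->
    newton_eqs (H z) (g z) z w mu d e -> l2norm d <= D0.
Proof.
move=> delta0; have [Gam Gam0 gB] := g_bounded B.
pose G0 := Gam + mu / delta.
have G00 : 0 <= G0 by rewrite addr_ge0// divr_ge0 ?ltW.
exists (p%:R * G0 / rho); first by rewrite divr_ge0 ?mulr_ge0 ?(ltW rho_gt0).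
move=> z w d e zdelta w0 zB nd.
have z0 : mx_pos z by move=> i j; rewrite ord1; exact: lt_le_trans (zdelta i).
have Gb i : `|G z i 0| <= G0.
  rewrite mxE; apply: le_trans (ler_normB _ _) _; rewrite lerD ?gB//.
  rewrite ger0_norm; last by rewrite divr_ge0 ?ltW.
  by rewrite ler_wpM2l ?(ltW mu_gt0)// lef_pV2 ?posrE.
have := newton_descent (H_coercive z) z0 w0 nd.
rewrite -/G => /le_trans/(_ (ler_norm _)); rewrite normrN.
move=> /le_trans/(_ (inner_le_entries _ Gb)).
have := l2norm_ge0 d; rewrite le_eqVlt => /predU1P[<- _|D0].
  by rewrite divr_ge0 ?mulr_ge0 ?(ltW rho_gt0).
rewrite ler_pdivlMr// => h; rewrite -(ler_pM2r D0); move: h; lra.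
Qed.

(** The accepted primal step is at least a constant depending only on [B] and
[delta]: the maximal step is bounded below since [z >= delta] and [d] is
bounded, and a rejected step cannot be short by
[backtracking_succeeds]. *)
Lemma pd_update_decrease (B delta : R) :
  0 < delta -> exists2 c, 0 < c & forall z w z' w' : 'cV[R]_p,
    (forall i, delta <= z i 0) -> mx_pos w -> l2norm z <= B ->
    pd_update z w z' w' ->
    exists d e a amax2, [/\ newton_eqs (H z) (g z) z w mu d e,
      max_step tau w e amax2, 0 <= a <= 1,
      z' = z + a *: d /\ w' = w + amax2 *: e &
      F z' <= F z - c * l2norm d ^+ 2].
Proof.
move=> delta0; have [D0 D00 dD0] := newton_direction_bound B delta0.
have [L L0 fL] := fg (Num.max B D0).
have tau1 : 0 < 1 - tau by rewrite subr_gt0.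
set K := L + mu / ((1 - tau) * delta ^+ 2).
have K0 : 0 <= K.
  by rewrite addr_ge0// divr_ge0 ?ltW// mulr_gt0// exprn_gt0.
have er0 : 0 < (1 - eta) * rho by rewrite mulr_gt0// subr_gt0.
(* A step length that always satisfies the boundary condition; adding 1 avoids
   a division by 0 when all directions vanish. *)
pose a0 := Num.min 1 (tau * delta / (D0 + 1)).
have a00 : 0 < a0.
  by rewrite lt_min ltr01/= divr_gt0 ?mulr_gt0// ltr_wpDl.
pose abar := Num.min a0 ((1 - eta) * rho / (2 * (K + 1))).
have K1 : 0 < K + 1 by rewrite ltr_wpDl.
have abar0 : 0 < abar by rewrite lt_min a00/= divr_gt0// mulr_gt0.
exists (eta * abar * rho); first by rewrite !mulr_gt0.
move=> z w z' w' zdelta w0 zB.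
move=> [d [e [a1 [a2 [t [nd m1 m2 [dec tmin] [-> ->]]]]]]].
have z0 : mx_pos z by move=> i j; rewrite ord1; exact: lt_le_trans (zdelta i).
have dB : l2norm d <= D0 by exact: dD0 nd.
have [[a10 a11 _] a1max] := m1.
have a0a1 : a0 <= a1.
  apply: a1max; split=> //; first by rewrite ge_min lexx.
  move=> i j; rewrite ord1 !mxE mulrBl mul1r lerD2l lerNl.
  apply: (@le_trans _ _ (a0 * (D0 + 1))).
    rewrite -mulrN ler_pM2l// (le_trans (ler_norm _))// normrN.
    by rewrite (le_trans (ler_l2norm_entry _ _ _))// (le_trans dB)// lerDl.
  rewrite -ler_pdivlMr ?ltr_wpDl//.
  apply: (@le_trans _ _ (tau * delta / (D0 + 1))).
    by rewrite ge_min lexx orbT.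
  by rewrite ler_pM2r ?invr_gt0 ?ltr_wpDl// ler_pM2l.
have alphaP s := halved_step_in s (ltW a10).
have alpha_large : abar <= 2^-1 ^+ t * a1.
  (* Either the maximal step is accepted, or twice the accepted step was
     rejected and so exceeds (1 - eta) rho / K. *)
  case: t => [|t] in dec tmin *.
    by rewrite expr0 mul1r ge_min a0a1.
  rewrite ge_min; apply/orP; right.
  rewrite ler_pdivrMr ?mulr_gt0// leNgt; apply/negP => small.
  apply: (tmin t) => //.
  apply: (backtracking_succeeds delta0 zdelta w0 nd m1 (alphaP t)).
  - have /andP[h0 h1] := alphaP t.
    apply: fL; rewrite ?le_max ?zB ?dB ?orbT//.
    by rewrite ger0_norm//; exact: le_trans a11.
  - have /andP[h0 h1] := alphaP t.
    by move: small; rewrite exprS -/K; nra.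
exists d, e, (2^-1 ^+ t * a1), a2; split=> //.
  by have /andP[-> /le_trans->] := alphaP t.
apply: le_trans dec _; rewrite lerD2l.
have slope := newton_descent (H_coercive z) z0 w0 nd.
have /andP[al0 _] := alphaP t.
have D2 : 0 <= rho * l2norm d ^+ 2 by rewrite mulr_ge0 ?sqr_ge0 ?ltW.
move: slope al0 alpha_large; set s := inner d _; set al := 2^-1 ^+ t * a1.
move=> slope al0 alpha_large.
have : eta * (abar * (rho * l2norm d ^+ 2)) <= eta * (al * - s).
  rewrite ler_pM2l//; apply: (@le_trans _ _ (al * (rho * l2norm d ^+ 2))).
    by rewrite ler_wpM2r.
  by rewrite ler_wpM2l.
by lra.
Qed.

(** Both terms on the left of the reduced system are [O(|d|)]. *)
Lemma newton_residual (B delta : R) :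
  0 < delta -> exists2 K, 0 <= K & forall z w d e : 'cV[R]_p,
    (forall i, delta <= z i 0) -> mx_pos w -> l2norm z <= B ->
    l2norm w <= B -> newton_eqs (H z) (g z) z w mu d e ->
    forall i, `|G z i 0| <= K * l2norm d.
Proof.
move=> delta0; have [Lam Lam0 HB] := H_bounded B.
exists (Lam + `|B| / delta); first by rewrite addr_ge0// divr_ge0// ltW.
move=> z w d e zdelta w0 zB wB nd i.
have z0 : mx_pos z by move=> k j; rewrite ord1; exact: lt_le_trans (zdelta k).
rewrite -normrN -(newton_eliminated i z0 nd) mulrDl.
apply: le_trans (ler_normD _ _) _; rewrite lerD ?HB// normrM.
rewrite ler_pM ?ler_l2norm_entry// normrM normfV (gtr0_norm (z0 i 0)) ler_pM//.
- by rewrite invr_ge0 ltW.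
- by rewrite (le_trans (ler_l2norm_entry w i 0))// (le_trans wB)// ler_norm.
- by rewrite lef_pV2 ?posrE.
Qed.

(** With [b] the multiplier step, the new multiplier minus [mu / z] equals
[(1 - b) (w - mu / z) - b w d / z].  The condition [B |d| <= mu] makes the
full step [w + e = (mu - w d) / z] nonnegative, hence [b >= tau].  The last
term of the bound also accounts for the change of [mu / z]. *)
Lemma multiplier_contraction (B delta : R) :
  0 < delta -> exists2 K, 0 <= K & forall (z w d e : 'cV[R]_p) (a b : R),
    (forall i, delta <= z i 0) -> (forall i, delta <= (z + a *: d) i 0) ->
    mx_pos w -> l2norm w <= B ->
    newton_eqs (H z) (g z) z w mu d e -> max_step tau w e b -> 0 <= a <= 1 ->
    B * l2norm d <= mu ->
    forall i, `|(w + b *: e) i 0 - mu / (z + a *: d) i 0|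
      <= (1 - tau) * `|w i 0 - mu / z i 0| + K * l2norm d.
Proof.
move=> delta0; exists (`|B| / delta + mu / delta ^+ 2).
  by rewrite addr_ge0// divr_ge0 ?sqr_ge0 ?(ltW delta0) ?(ltW mu_gt0).
move=> z w d e a b zdelta zdelta' w0 wB nd [[b0 b1 _] bmax] /andP[a0 a1] Bd i.
have z0 k : 0 < z k 0 by exact: lt_le_trans (zdelta k).
have z0' k : 0 < (z + a *: d) k 0 by exact: lt_le_trans (zdelta' k).
have D0 := l2norm_ge0 d.
have dD k : `|d k 0| <= l2norm d by exact: ler_l2norm_entry.
have wB' k : `|w k 0| <= B by exact: le_trans (ler_l2norm_entry w k 0) wB.
have weE k : e k 0 = mu / z k 0 - w k 0 - w k 0 * d k 0 / z k 0.
  have zk : z k 0 != 0 by rewrite gt_eqF.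
  apply: (mulfI zk); have := nd.2 k; rewrite !mulrBr => h.
  have -> : z k 0 * (mu / z k 0) = mu by rewrite mulrC divfK.
  have -> : z k 0 * (w k 0 * d k 0 / z k 0) = w k 0 * d k 0.
    by rewrite mulrC divfK.
  by lra.
(* The step tau is admissible as w + tau e = (1 - tau) w + tau (w + e). *)
have taub : tau <= b.
  apply: bmax; split=> //; first exact: ltW.
  move=> k j; rewrite ord1 !mxE.
  have wd : w k 0 * d k 0 <= mu.
    apply: le_trans (ler_norm _) _; apply: le_trans Bd.
    by rewrite normrM ler_pM.
  have : 0 <= (mu - w k 0 * d k 0) / z k 0 by rewrite divr_ge0 ?subr_ge0// ltW.
  rewrite mulrBl => we0.
  have : 0 <= tau * (w k 0 + e k 0).
    by rewrite mulr_ge0 ?(ltW tau_gt0)// weE; lra.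
  by lra.
set z' := (z + a *: d) i 0.
have -> : (w + b *: e) i 0 - mu / z' = (1 - b) * (w i 0 - mu / z i 0)
    - b * (w i 0 * d i 0 / z i 0) + (mu / z i 0 - mu / z').
  by rewrite !mxE weE; ring.
apply: le_trans (ler_normD _ _) _.
rewrite [(_ + mu / _) * _]mulrDl [leRHS]addrA lerD//.
  apply: le_trans (ler_normB _ _) _; rewrite lerD// normrM.
    rewrite ger0_norm ?subr_ge0// ler_wpM2r//; lra.
  rewrite ger0_norm ?(ltW b0)//.
  apply: (@le_trans _ _ (1 * `|w i 0 * d i 0 / z i 0|)).
    by rewrite ler_wpM2r.
  rewrite mul1r !normrM mulrAC ler_pM// ?mulr_ge0//.
    rewrite ler_pM//; last first.
      by rewrite normfV gtr0_norm// lef_pV2 ?posrE.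
    exact: le_trans (ler_norm B).
have -> : mu / z i 0 - mu / z' = mu * a * d i 0 / (z i 0 * z').
  have : z i 0 != 0 by rewrite gt_eqF.
  have : z i 0 + a * d i 0 != 0 by have := z0' i; rewrite !mxE => /gt_eqF->.
  by rewrite /z' !mxE => h1 h2; field; rewrite h1.
rewrite normrM normfV [`|z i 0 * _|]gtr0_norm ?mulr_gt0//; last exact: z0'.
rewrite [leRHS]mulrAC ler_pM ?invr_ge0//.
- by rewrite ltW// mulr_gt0// z0'.
- rewrite -mulrA normrM gtr0_norm// ler_pM2l// normrM ger0_norm//.
  by apply: le_trans (dD i); rewrite -[leRHS]mul1r ler_wpM2r.
rewrite lef_pV2 ?posrE ?exprn_gt0// ?mulr_gt0//; last exact: z0'.
by rewrite expr2 ler_pM ?(ltW delta0)//; exact: zdelta'.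
Qed.

(** The decrease of [F] forces [d] to 0; summing [multiplier_contraction] over
the coordinates forces [w - mu / z] to 0; the residuals follow. *)
Theorem pd_iteration_converges (z w : nat -> 'cV[R]_p) (B : R) :
  mx_pos (z 0%N) -> mx_pos (w 0%N) ->
  (forall N, l2norm (z N) <= B) -> (forall N, l2norm (w N) <= B) ->
  (forall N, pd_update (z N) (w N) (z N.+1) (w N.+1)) ->
  forall e, 0 < e -> exists N, forall i,
    `|g (z N) i 0 - w N i 0| <= e /\ `|z N i 0 * w N i 0 - mu| <= e.
Proof.
move=> z00 w00 zB wB upd eps eps0.
have pos N : mx_pos (z N) /\ mx_pos (w N).
  by elim: N => [//|N [zN wN]]; exact: pd_update_pos (upd N).
have [delta delta0 deltaP] := sublevel_lower_bound B (F (z 0%N)).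
(* Monotonicity has to be known before the uniform lower bound delta; it uses
   the decrease with a lower bound d1 that depends on N. *)
have Fdecr N : F (z N.+1) <= F (z N).
  have [d1 d1P zd1] := lower_bound_pos (pos N).1.
  have [c c0 cP] := pd_update_decrease B d1P.
  have [d [e [a [b [_ _ _ _ h]]]]] := cP _ _ _ _ zd1 (pos N).2 (zB N) (upd N).
  by apply: le_trans h _; rewrite gerBl mulr_ge0 ?sqr_ge0// ltW.
have zdelta N i : delta <= z N i 0.
  apply: deltaP => //; first exact: (pos N).1.
  by elim: N => [//|N IH]; exact: le_trans (Fdecr N) IH.
have [c c0 cP] := pd_update_decrease B delta0.
have [K1 K10 K1P] := newton_residual B delta0.
have [K2 K20 K2P] := multiplier_contraction B delta0.
have /choice[d dP] : forall N, exists d : 'cV[R]_p,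
    [/\ F (z N.+1) <= F (z N) - c * l2norm d ^+ 2,
        forall i, `|G (z N) i 0| <= K1 * l2norm d &
        B * l2norm d <= mu -> forall i,
          `|w N.+1 i 0 - mu / z N.+1 i 0|
          <= (1 - tau) * `|w N i 0 - mu / z N i 0| + K2 * l2norm d].
  move=> N; have [zN wN] := pos N.
  have [d [e [a [b [nd m aa [zE wE] h]]]]] :=
    cP _ _ _ _ (zdelta N) wN (zB N) (upd N).
  exists d; split=> //; first exact: K1P (zdelta N) wN (zB N) (wB N) nd.
  move=> Bd; rewrite zE wE; apply: K2P nd _ _ _ => //.
  by rewrite -zE.
pose D N := l2norm (d N).
have D0 : D @ \oo --> 0.
  have Fcvg : cvgn (F \o z).
    apply: nonincreasing_is_cvgn.
      by apply/nonincreasing_seqP.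
    exists (- (mu * (p%:R * B))) => _ [N _ <-] /=.
    rewrite /F /barrier_fun; have := f_ge0 (z N).
    suff : mu * (\sum_i ln (z N i 0)) <= mu * (p%:R * B) by lra.
    rewrite ler_pM2l// mulr_natl -[X in _ *+ X]card_ord -sumr_const.
    apply: ler_sum => i _.
    apply: le_trans (ltW (ln_sublinear ((pos N).1 i 0))) _.
    by apply: le_trans (ler_norm _) (le_trans (ler_l2norm_entry _ i 0) (zB N)).
  have dF : (fun N => F (z N) - F (z N.+1)) @ \oo --> 0.
    rewrite -(subrr (limn (F \o z))); apply: cvgB => //.
    by have := Fcvg; rewrite -cvg_shiftS; apply.
  apply/cvgrPdist_le => e e0.
  have ce : 0 < c * e ^+ 2 by rewrite mulr_gt0// exprn_gt0.
  have /cvgrPdist_le/(_ _ ce)[N0 _ hN] := dF.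
  exists N0 => // N /= N0N; rewrite sub0r normrN ger0_norm ?l2norm_ge0//.
  have := hN _ N0N; rewrite sub0r normrN => /(le_trans (ler_norm _)) h.
  rewrite -(@ler_pXn2r _ 2)// ?nnegrE ?l2norm_ge0 ?(ltW e0)//.
  rewrite -(ler_pM2l c0); apply: le_trans h.
  by have [h _ _] := dP N; move: h; rewrite /D; lra.
(* Summing over the coordinates keeps a single recursion with ratio 1 - tau. *)
pose u N := \sum_i `|w N i 0 - mu / z N i 0|.
have u0 N : 0 <= u N by apply: sumr_ge0.
have KD K : (fun N => K * D N) @ \oo --> 0.
  by rewrite -(mulr0 K); apply: cvgM => //; exact: cvg_cst.
have ucvg : u @ \oo --> 0.
  apply: (@contraction_to0 _ (1 - tau) _ (fun N => (p%:R * K2) * D N)) => //.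
    by rewrite subr_ge0 ltW//= gtrBl.
  have /cvgrPdist_le/(_ _ mu_gt0) := KD B.
  apply: filterS => N; rewrite sub0r normrN => /(le_trans (ler_norm _)) BD.
  have [_ _ /(_ BD) h] := dP N.
  rewrite /u mulr_sumr -mulrA mulr_natl -[X in _ *+ X]card_ord -sumr_const.
  by rewrite -big_split/=; apply: ler_sum => i _.
have e1 : 0 < eps / (`|B| + 1) by rewrite divr_gt0// ltr_wpDl.
have e2 : 0 < eps / 2 by rewrite divr_gt0.
have /cvgrPdist_le/(_ _ e1) ev1 := ucvg.
have /cvgrPdist_le/(_ _ e2) ev2 := ucvg.
have /cvgrPdist_le/(_ _ e2) ev3 := KD K1.
have [N _ /(_ N (leqnn N))[[h1 h2] h3]] := filterI (filterI ev1 ev2) ev3.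
exists N => i; move: h1 h2 h3; rewrite !sub0r !normrN.
rewrite (ger0_norm (u0 N)) (ger0_norm (mulr_ge0 K10 (l2norm_ge0 (d N)))).
move=> h1 h2 h3; have ui : `|w N i 0 - mu / z N i 0| <= u N.
  by rewrite /u (bigD1 i)//= lerDl sumr_ge0.
have zi : z N i 0 != 0 by rewrite gt_eqF// (pos N).1.
split.
  have -> : g (z N) i 0 - w N i 0 = G (z N) i 0 - (w N i 0 - mu / z N i 0).
    by rewrite mxE; ring.
  apply: le_trans (ler_normB _ _) _.
  have [_ /(_ i) hG _] := dP N; rewrite [leRHS]splitr lerD//.
    exact: le_trans hG h3.
  exact: le_trans ui h2.
have -> : z N i 0 * w N i 0 - mu = z N i 0 * (w N i 0 - mu / z N i 0).
  by rewrite mulrBr [X in _ = _ - X]mulrC divfK.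
rewrite normrM; apply: (@le_trans _ _ ((`|B| + 1) * (eps / (`|B| + 1)))).
  rewrite ler_pM//; last exact: le_trans ui h1.
  apply: le_trans (ler_l2norm_entry _ _ _) (le_trans (zB N) _).
  by rewrite (le_trans (ler_norm B))// lerDl.
by rewrite mulrC divfK// gt_eqF// ltr_wpDl.
Qed.

End PrimalDualIteration.

(** * The factorization loss and its Gauss-Newton matrix *)

Lemma sum_mxvec_index (R : realType) (p k : nat) (F : 'I_(p * k) -> R) :
  \sum_u F u = \sum_i \sum_a F (mxvec_index i a).
Proof.
rewrite pair_big/= (reindex _ (curry_mxvec_bij p k))/=.
by apply: eq_bigr => -[].
Qed.

Lemma mxvec_colP (R : realType) (p k : nat) (u v : 'cV[R]_(p * k)) :
  (forall i a, u (mxvec_index i a) 0 = v (mxvec_index i a) 0) -> u = v.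
Proof.
move=> uv; apply/matrixP => l j; rewrite ord1.
by case/mxvec_indexP: l => i a; exact: uv.
Qed.

Lemma vecE (R : realType) (k m : nat) (A : 'M[R]_(k, m)) j a :
  vec A (mxvec_index j a) 0 = A a j.
Proof. by rewrite mxE mxvecE mxE. Qed.

Lemma matXE (R : realType) (n k : nat) (x : 'cV[R]_(n * k)) i a :
  matX x i a = x (mxvec_index i a) 0.
Proof. by rewrite !mxE. Qed.

Lemma matYE (R : realType) (m k : nat) (y : 'cV[R]_(m * k)) a j :
  matY y a j = y (mxvec_index j a) 0.
Proof. by rewrite !mxE. Qed.

Lemma matX_lin (R : realType) (n k : nat) (x d : 'cV[R]_(n * k)) h :
  matX (x + h *: d) = matX x + h *: matX d.
Proof. by apply/matrixP => i a; rewrite !(matXE, mxE). Qed.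

Lemma matY_lin (R : realType) (m k : nat) (y d : 'cV[R]_(m * k)) h :
  matY (y + h *: d) = matY y + h *: matY d.
Proof. by apply/matrixP => i a; rewrite !(matYE, mxE). Qed.

Section LeastSquares.
Context (R : realType) (n m k : nat) (M : 'M[R]_(n, m)).
Local Notation vector := 'cV[R]_(n * k + m * k).
Implicit Types z d v : vector.

Definition Xof z : 'M[R]_(n, k) := matX (usubmx z).
Definition Yof z : 'M[R]_(k, m) := matY (dsubmx z).

Definition residual z : 'M[R]_(n, m) := Xof z *m Yof z - M.

Definition sq_loss z : R := 2^-1 * l2norm (residual z) ^+ 2.

(** The derivative of [(X, Y) |-> X Y] at [z] in the direction [d]. *)
Definition product_diff z d : 'M[R]_(n, m) :=
  Xof d *m Yof z + Xof z *m Yof d.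

(** The adjoint of [product_diff z], by [inner_product_adj]; applied to the
residual it is the gradient of the loss. *)
Definition product_adj z (A : 'M[R]_(n, m)) : vector :=
  col_mx (vec (Yof z *m A^T)) (vec ((Xof z)^T *m A)).

Definition loss_grad z : vector := product_adj z (residual z).

Definition gn_matrix (rho : R) z : 'M[R]_(n * k + m * k) :=
  block_mx (Q1 n (dsubmx z) + rho%:M) (Cbar (usubmx z) (dsubmx z))^T
           (Cbar (usubmx z) (dsubmx z)) (Q2 m (usubmx z) + rho%:M).

Lemma inner_product_adj z d (A : 'M[R]_(n, m)) :
  inner d (product_adj z A) = \sum_i \sum_j product_diff z d i j * A i j.
Proof.
rewrite innerE big_split_ord/= !sum_mxvec_index.
have -> : \sum_i \sum_j product_diff z d i j * A i j =
  \sum_i \sum_j (Xof d *m Yof z) i j * A i j +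
  \sum_i \sum_j (Xof z *m Yof d) i j * A i j.
  rewrite -big_split; apply: eq_bigr => i _; rewrite -big_split/=.
  by apply: eq_bigr => j _; rewrite mxE mulrDl.
congr (_ + _).
  apply: eq_bigr => i _.
  under eq_bigr => a _.
    rewrite col_mxEu vecE mxE mulr_sumr.
    over.
  rewrite exchange_big/=; apply: eq_bigr => j _.
  rewrite [in RHS]mxE mulr_suml; apply: eq_bigr => a _.
  by rewrite /Xof matXE !mxE mulrA.
rewrite [RHS]exchange_big/=; apply: eq_bigr => j _.
under eq_bigr => a _.
  rewrite col_mxEd vecE mxE mulr_sumr.
  over.
rewrite exchange_big/=; apply: eq_bigr => i _.
rewrite [in RHS]mxE mulr_suml; apply: eq_bigr => a _.
by rewrite /Yof matYE !mxE; ring.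
Qed.

(** The blocks [Q1], [Q2] and [Cbar] are exactly those of the composition of
[product_diff z] with its adjoint. *)
Lemma gn_matrix_mul rho z d :
  gn_matrix rho z *m d = product_adj z (product_diff z d) + rho *: d.
Proof.
have -> : rho *: d = col_mx (rho *: usubmx d) (rho *: dsubmx d).
  by rewrite -scale_col_mx vsubmxK.
rewrite -{1}[d]vsubmxK mul_block_col !mulmxDl !mul_scalar_mx add_col_mx.
set dx := usubmx d; set dy := dsubmx d.
congr col_mx.
  rewrite addrAC; congr (_ + _); apply: mxvec_colP => i a.
  rewrite vecE /product_diff linearD/= mulmxDr mxE [RHS]mxE; congr (_ + _).
    rewrite mxE sum_mxvec_index (bigD1 i)//= [X in _ + X]big1 ?addr0;
      last first.
      move=> j ji; rewrite big1// => b _.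
      by rewrite blocksE eq_sym (negbTE ji) mxE mul0r.
    rewrite trmx_mul mulmxA [RHS]mxE; apply: eq_bigr => b _.
    by rewrite blocksE eqxx [(Xof d)^T _ _]mxE matXE.
  rewrite !mxE sum_mxvec_index; apply: eq_bigr => j _.
  rewrite [(Xof z *m Yof d)^T _ _]mxE [(Xof z *m Yof d) _ _]mxE mulr_sumr.
  apply: eq_bigr => b _.
  rewrite [(Cbar _ _)^T _ _]mxE blocksE mxE big_ord1 !mxE; ring.
rewrite addrA; congr (_ + _); apply: mxvec_colP => j a.
rewrite vecE /product_diff mulmxDr mxE [RHS]mxE; congr (_ + _).
  rewrite !mxE sum_mxvec_index; apply: eq_bigr => i _.
  rewrite [(Xof d *m Yof z) _ _]mxE mulr_sumr.
  apply: eq_bigr => b _.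
  rewrite blocksE mxE big_ord1 !mxE; ring.
rewrite mxE sum_mxvec_index (bigD1 j)//= [X in _ + X]big1 ?addr0; last first.
  move=> i ij; rewrite big1// => b _.
  by rewrite blocksE eq_sym (negbTE ij) mxE mul0r.
rewrite mulmxA [RHS]mxE; apply: eq_bigr => b _.
by rewrite blocksE eqxx matYE.
Qed.

(** By adjointness the quadratic form is the squared Frobenius norm of
[product_diff z v] plus [rho |v|^2]. *)
Lemma gn_matrix_coercive rho : coercive rho (gn_matrix rho).
Proof.
move=> z v; rewrite gn_matrix_mul.
have -> : inner v (product_adj z (product_diff z v) + rho *: v)
  = inner v (product_adj z (product_diff z v)) + rho * inner v v.
  by rewrite /inner mulmxDr -scalemxAr !mxE.
rewrite inner_self inner_product_adj lerDr.
by do 2![apply: sumr_ge0 => ? _]; rewrite -expr2 sqr_ge0.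
Qed.

Lemma ler_Xof z i a : `|Xof z i a| <= l2norm z.
Proof. by rewrite /Xof matXE mxE ler_l2norm_entry. Qed.

Lemma ler_Yof z a j : `|Yof z a j| <= l2norm z.
Proof. by rewrite /Yof matYE mxE ler_l2norm_entry. Qed.

Lemma ler_product_diff z d i j :
  `|product_diff z d i j| <= k%:R * (2 * l2norm z) * l2norm d.
Proof.
rewrite mxE; apply: le_trans (ler_normD _ _) _.
have := ler_mulmx_entry i j (ler_Xof d) (ler_Yof z).
have := ler_mulmx_entry i j (ler_Xof z) (ler_Yof d).
lra.
Qed.

Lemma ler_residual z i j :
  `|residual z i j| <= k%:R * l2norm z ^+ 2 + l2norm M.
Proof.
rewrite mxE; apply: le_trans (ler_normD _ _) _; rewrite lerD//.
  by rewrite expr2; exact: ler_mulmx_entry (ler_Xof z) (ler_Yof z).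
by rewrite mxE normrN ler_l2norm_entry.
Qed.

Lemma ler_product_adj z (A : 'M[R]_(n, m)) (a : R) l :
  0 <= a -> (forall i j, `|A i j| <= a) ->
  `|product_adj z A l 0| <= (n + m)%:R * (l2norm z * a).
Proof.
move=> a0 Aa; have za0 : 0 <= l2norm z * a by rewrite mulr_ge0 ?l2norm_ge0.
rewrite natrD mulrDl; case: (split_ordP l) => u ->.
  rewrite col_mxEu; case/mxvec_indexP: u => i b; rewrite vecE.
  apply: (@le_trans _ _ (m%:R * (l2norm z * a))).
    by apply: ler_mulmx_entry => *; [exact: ler_Yof|rewrite mxE].
  by rewrite lerDr mulr_ge0.
rewrite col_mxEd; case/mxvec_indexP: u => j b; rewrite vecE.
apply: (@le_trans _ _ (n%:R * (l2norm z * a))).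
  by apply: ler_mulmx_entry => *; [rewrite mxE; exact: ler_Xof|].
by rewrite lerDl mulr_ge0.
Qed.

Lemma gn_matrix_bounded rho :
  0 <= rho -> operator_bounded_on_balls (gn_matrix rho).
Proof.
move=> rho0 B.
exists ((n + m)%:R * (`|B| * (k%:R * (2 * `|B|))) + rho).
  by rewrite addr_ge0// !mulr_ge0.
move=> z v zB l; rewrite gn_matrix_mul mxE mulrDl.
have z0 := l2norm_ge0 z; have v0 := l2norm_ge0 v.
have zB' : l2norm z <= `|B| by exact: le_trans (ler_norm B).
apply: le_trans (ler_normD _ _) _; rewrite lerD//; last first.
  by rewrite mxE normrM ger0_norm// ler_wpM2l// ler_l2norm_entry.
have a0 : 0 <= k%:R * (2 * l2norm z) * l2norm v by rewrite !mulr_ge0.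
apply: le_trans (ler_product_adj z l a0 (ler_product_diff z v)) _.
rewrite -!mulrA ler_wpM2l// !mulrA ler_wpM2r//.
rewrite -!mulrA ler_pM ?mulr_ge0// ler_wpM2l// ler_wpM2l//.
Qed.

Lemma loss_grad_bounded : bounded_on_balls loss_grad.
Proof.
move=> B.
exists ((n + m)%:R * (`|B| * (k%:R * `|B| ^+ 2 + l2norm M))).
  by rewrite !mulr_ge0 ?addr_ge0 ?mulr_ge0 ?l2norm_ge0 ?sqr_ge0.
move=> z zB l; have z0 := l2norm_ge0 z.
have zB' : l2norm z <= `|B| by exact: le_trans (ler_norm B).
have a0 : 0 <= k%:R * l2norm z ^+ 2 + l2norm M.
  by rewrite addr_ge0 ?mulr_ge0 ?l2norm_ge0 ?sqr_ge0.
apply: le_trans (ler_product_adj z l a0 (ler_residual z)) _.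
rewrite ler_wpM2l// ler_pM// lerD2r ler_wpM2l//.
by rewrite lerXn2r// nnegrE.
Qed.

Lemma residual_line z d h i j :
  residual (z + h *: d) i j
  = residual z i j + h * product_diff z d i j + h ^+ 2 * (Xof d *m Yof d) i j.
Proof.
have -> : residual (z + h *: d)
    = residual z + h *: product_diff z d + h ^+ 2 *: (Xof d *m Yof d);
    last first.
  move: (residual z) (product_diff z d) (Xof d *m Yof d) => A J Q.
  by rewrite !mxE.
rewrite /residual /product_diff /Xof /Yof.
have -> : usubmx (z + h *: d) = usubmx z + h *: usubmx d.
  by rewrite linearD linearZ.
have -> : dsubmx (z + h *: d) = dsubmx z + h *: dsubmx d.
  by rewrite linearD linearZ.
rewrite matX_lin matY_lin mulmxDl !mulmxDr -!scalemxAl -!scalemxAr.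
rewrite scalerA -expr2 scalerDr.
move: (_ *m _) (_ *m _) (_ *m _) (_ *m _) => P1 P2 P3 P4.
by apply/matrixP => l l'; rewrite !mxE; ring.
Qed.

(** Along a line the residual is a polynomial of degree 2 in the parameter, so
the loss is an explicit polynomial of degree 4; its terms of degree at least
2 are bounded entry by entry. *)
Lemma sq_loss_quadratic : quadratic_model sq_loss loss_grad.
Proof.
move=> B; set b := `|B|; have b0 : 0 <= b by exact: normr_ge0.
pose a0 := k%:R * b ^+ 2 + l2norm M.
pose j0 := k%:R * (2 * b).
pose g0 : R := k%:R.
have a00 : 0 <= a0 by rewrite addr_ge0 ?mulr_ge0 ?sqr_ge0 ?l2norm_ge0.
have j00 : 0 <= j0 by rewrite !mulr_ge0.
have g00 : 0 <= g0 by exact: ler0n.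
pose e0 := j0 ^+ 2 + a0 * g0 + j0 * (g0 * b) + (g0 * b) ^+ 2.
exists (n%:R * (m%:R * e0)).
  by rewrite !mulr_ge0// !addr_ge0 ?sqr_ge0// !mulr_ge0.
move=> z d h zB dB h1; set D := l2norm d.
have D0 : 0 <= D by exact: l2norm_ge0.
have zb : l2norm z <= b by exact: le_trans (ler_norm B).
have Db : D <= b by exact: le_trans (ler_norm B).
have z0 := l2norm_ge0 z.
rewrite inner_product_adj /sq_loss !l2norm_sqr.
have -> : 2^-1 * (\sum_i \sum_j residual (z + h *: d) i j ^+ 2)
    - 2^-1 * (\sum_i \sum_j residual z i j ^+ 2)
    - h * (\sum_i \sum_j product_diff z d i j * residual z i j)
  = \sum_i \sum_j (2^-1 * residual (z + h *: d) i j ^+ 2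
     - 2^-1 * residual z i j ^+ 2
     - h * (product_diff z d i j * residual z i j)).
  rewrite !mulr_sumr -!sumrB; apply: eq_bigr => i _.
  by rewrite !mulr_sumr -!sumrB.
have entry i j : `|2^-1 * residual (z + h *: d) i j ^+ 2
     - 2^-1 * residual z i j ^+ 2 - h * (product_diff z d i j * residual z i j)|
    <= e0 * (h * D) ^+ 2.
  rewrite residual_line.
  have := le_trans (ler_residual z i j) _.
  move=> /(_ a0); rewrite lerD2r ler_wpM2l ?lerXn2r ?nnegrE// => /(_ isT).
  have := ler_product_diff z d i j; rewrite -/D => jD.
  have {}jD : `|product_diff z d i j| <= j0 * D.
    by apply: le_trans jD _; rewrite ler_wpM2r// ler_wpM2l// ler_wpM2l.
  have := ler_mulmx_entry i j (ler_Xof d) (ler_Yof d); rewrite -/D -/g0.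
  move: jD; set A := residual z i j; set J := product_diff z d i j.
  set Q := (_ *m _) i j => jD gD aA.
  have gbD : `|Q| <= (g0 * b) * D.
    by apply: le_trans gD _; rewrite mulrA ler_wpM2r// ler_wpM2l.
  have -> : 2^-1 * (A + h * J + h ^+ 2 * Q) ^+ 2 - 2^-1 * A ^+ 2 - h * (J * A)
    = h ^+ 2 * (2^-1 * J ^+ 2 + A * Q + h * (J * Q) + 2^-1 * (h * Q) ^+ 2).
    by field.
  rewrite normrM (ger0_norm (sqr_ge0 h)) [(h * D) ^+ 2]exprMn.
  rewrite [leRHS]mulrCA ler_wpM2l ?sqr_ge0//.
  have jj : 2^-1 * J ^+ 2 <= j0 ^+ 2 * D ^+ 2.
    rewrite -exprMn -(real_normK (num_real J)).
    apply: (@le_trans _ _ (1 * `|J| ^+ 2)).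
      by rewrite ler_wpM2r ?sqr_ge0// invf_le1// ler1n.
    by rewrite mul1r lerXn2r ?nnegrE// mulr_ge0.
  have aq : `|A * Q| <= a0 * g0 * D ^+ 2.
    by rewrite normrM -[leRHS]mulrA; apply: ler_pM => //.
  have jq : `|h * (J * Q)| <= j0 * (g0 * b) * D ^+ 2.
    rewrite normrM -[leRHS]mul1r ler_pM// normrM.
    by apply: (@le_trans _ _ ((j0 * D) * ((g0 * b) * D))); [rewrite ler_pM|lra].
  have qq : 2^-1 * (h * Q) ^+ 2 <= (g0 * b) ^+ 2 * D ^+ 2.
    rewrite -exprMn -(real_normK (num_real (h * Q))).
    apply: (@le_trans _ _ (1 * `|h * Q| ^+ 2)).
      by rewrite ler_wpM2r ?sqr_ge0// invf_le1// ler1n.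
    rewrite mul1r lerXn2r ?nnegrE// ?mulr_ge0//.
    by rewrite normrM -[leRHS]mul1r ler_pM.
  have -> : e0 * D ^+ 2 = j0 ^+ 2 * D ^+ 2 + a0 * g0 * D ^+ 2
      + j0 * (g0 * b) * D ^+ 2 + (g0 * b) ^+ 2 * D ^+ 2.
    by rewrite /e0; ring.
  apply: le_trans (ler_normD _ _) _.
  rewrite lerD//; last by rewrite ger0_norm// mulr_ge0 ?sqr_ge0.
  apply: le_trans (ler_normD _ _) _; rewrite lerD//.
  apply: le_trans (ler_normD _ _) _; rewrite lerD//.
  by rewrite ger0_norm// mulr_ge0 ?sqr_ge0.
rewrite -!mulrA; apply: ler_norm_sum_ord => i; apply: ler_norm_sum_ord => j.
exact: entry.
Qed.

Lemma sq_loss_ge0 z : 0 <= sq_loss z.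
Proof. by rewrite mulr_ge0 ?sqr_ge0// invr_ge0. Qed.

End LeastSquares.

(** * The inner loop of the algorithm *)

Section Algorithm.
Context (R : realType) (n m k : nat) (M : 'M[R]_(n, m))
  (rho tau eta : R).
Hypotheses (rho_gt0 : 0 < rho) (tau_gt0 : 0 < tau) (tau_lt1 : tau < 1)
  (eta_gt0 : 0 < eta) (eta_lt1 : eta < 1).
Local Notation point := (pd_point R n m k).
Implicit Types w d : point.

Definition primal w := col_mx (px w) (py w).
Definition dual w := col_mx (pr w) (ps w).

Lemma positiveE w : positive w <-> mx_pos (primal w) /\ mx_pos (dual w).
Proof.
split=> [[x0 y0 r0 s0]|[/mx_pos_col[x0 y0] /mx_pos_col[r0 s0]]] => //.
by split; apply/mx_pos_col.
Qed.

Lemma phiE mu (x : 'cV[R]_(n * k)) (y : 'cV[R]_(m * k)) :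
  phi M mu x y = barrier_fun (sq_loss M) mu (col_mx x y).
Proof.
rewrite /phi /barrier_fun /sq_loss /residual /Xof /Yof col_mxKu col_mxKd.
rewrite big_split_ord/= mulrDr opprD addrA.
by congr (_ - _ * _ - _ * _); apply: eq_bigr => i _;
  rewrite ?col_mxEu ?col_mxEd.
Qed.

Lemma grad_phiE mu w : 0 < mu -> positive w ->
  grad_phi M mu (px w) (py w) = barrier_grad (loss_grad M) mu (primal w).
Proof.
move=> mu0 /positiveE[z0 _].
rewrite -(grad_barrier (sq_loss_quadratic k M) mu0 z0) /grad_phi.
congr grad; apply/funext => z.
by rewrite phiE vsubmxK.
Qed.

Lemma loss_grad_col (x : 'cV[R]_(n * k)) (y : 'cV[R]_(m * k)) :
  loss_grad M (col_mx x y) = col_mx (graX M x y) (graY M x y).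
Proof.
by rewrite /loss_grad /product_adj /residual /Xof /Yof col_mxKu col_mxKd.
Qed.

(** The block system is [newton_eqs] for the Gauss-Newton matrix on the stacked
vectors. *)
Lemma primal_dual_directionE w mu d :
  primal_dual_direction M rho w mu d <->
  newton_eqs (gn_matrix rho (primal w)) (loss_grad M (primal w))
    (primal w) (dual w) mu (primal d) (dual d).
Proof.
rewrite /primal_dual_direction /kkt_matrix /kkt_rhs /stack mul_block_col.
have negE : block_mx (- 1%:M) 0 0 (- 1%:M) *m dual d = - dual d.
  by rewrite mul_block_col !mul0mx addr0 add0r !mulNmx !mul1mx opp_col_mx.
have diagE (a u : 'cV[R]_(n * k)) (b v : 'cV[R]_(m * k)) :
    block_mx (Diag a) 0 0 (Diag b) *m col_mx u v
    = col_mx (Diag a *m u) (Diag b *m v).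
  by rewrite mul_block_col !mul0mx addr0 add0r.
rewrite -/(primal d) -/(dual d) negE !diagE add_col_mx /newton_eqs.
rewrite loss_grad_col /gn_matrix col_mxKu col_mxKd [dual w]/dual.
rewrite [in X in _ = X /\ _]opp_col_mx add_col_mx.
have sumE (p : nat) (a b u v : 'cV[R]_p) i :
    (Diag a *m u + Diag b *m v) i 0 = a i 0 * u i 0 + b i 0 * v i 0.
  by rewrite mxE !Diag_mul.
have rhsE (p : nat) (a u : 'cV[R]_p) i :
    (mu *: ones R p - Diag a *m u) i 0 = mu - a i 0 * u i 0.
  by rewrite mxE [(- _ : 'cV__) _ _]mxE Diag_mul !mxE mulr1.
split=> [/eq_col_mx[-> e2]|[-> e2]].
  split=> // i; move/matrixP: e2 => /(_ i 0).
  by case: (split_ordP i) => l ->; rewrite ?col_mxEu ?col_mxEd sumE rhsE.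
congr col_mx; apply/matrixP => i j; rewrite ord1; have := e2 i.
by case: (split_ordP i) => l ->; rewrite ?col_mxEu ?col_mxEd sumE rhsE.
Qed.

Local Notation update mu :=
  (pd_update (sq_loss M) (loss_grad M) (gn_matrix rho) tau eta mu).

(** Stacking identifies an iteration of the algorithm with [pd_update]; the
partial derivatives in the Armijo test are evaluated by [grad_phiE]. *)
Lemma inner_iterationE mu w w' : 0 < mu -> positive w ->
  inner_iteration M rho tau eta mu w w' <->
  update mu (primal w) (dual w) (primal w') (dual w').
Proof.
move=> mu0 w0.
have lin (x dx : 'cV[R]_(n * k)) (y dy : 'cV[R]_(m * k)) (a : R) :
    col_mx (x + a *: dx) (y + a *: dy) = col_mx x y + a *: col_mx dx dy.
  by rewrite scale_col_mx add_col_mx.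
have armijoE d a : armijo M eta mu w d a <->
    sufficient_decrease (barrier_fun (sq_loss M) mu) eta
      (inner (primal d) (barrier_grad (loss_grad M) mu (primal w)))
      (primal w) (primal d) a.
  by rewrite /armijo /sufficient_decrease !phiE lin grad_phiE.
split=> [[d [a1 [a2 [t [nd m1 m2 [dec tmin] ->]]]]]|
         [dz [e [a1 [a2 [t [nd m1 m2 [dec tmin] [zE wE]]]]]]]].
  exists (primal d), (dual d), a1, a2, t; split.
  - exact/primal_dual_directionE.
  - by rewrite -boundary_stepE.
  - by rewrite -boundary_stepE.
  - by split=> [|t' /tmin nd' /armijoE]; first exact/armijoE.
  - by rewrite /primal /dual/= !lin.
pose d : point := Point (usubmx dz) (dsubmx dz) (usubmx e) (dsubmx e).
have dE : primal d = dz by exact: vsubmxK.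
have eE : dual d = e by exact: vsubmxK.
exists d, a1, a2, t; split.
- by apply/primal_dual_directionE; rewrite dE eE.
- by rewrite boundary_stepE -/(primal w) -/(primal d) dE.
- by rewrite boundary_stepE -/(dual w) -/(dual d) eE.
- split=> [|t' /tmin nd' /armijoE]; first by apply/armijoE; rewrite dE.
  by rewrite dE.
move: zE wE; rewrite -dE -eE -!lin /primal /dual.
move=> /eq_col_mx[xE yE] /eq_col_mx[rE sE].
by case: w' xE yE rE sE => x y r s /= -> -> -> ->.
Qed.

Lemma complementarity_entry w mu i :
  (col_mx (Diag (px w) *m pr w) (Diag (py w) *m ps w)
    - mu *: ones R (n * k + m * k)) i 0 = primal w i 0 * dual w i 0 - mu.
Proof.
rewrite mxE; congr (_ + _); last by rewrite !mxE mulr1.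
case: (split_ordP i) => l ->;
  by rewrite /primal /dual ?col_mxEu ?col_mxEd Diag_mul.
Qed.

Lemma E_le w mu e :
  (forall i, `|loss_grad M (primal w) i 0 - dual w i 0| <= e) ->
  (forall i, `|primal w i 0 * dual w i 0 - mu| <= e) ->
  E M w mu <= (n * k + m * k)%:R * e.
Proof.
move=> ge ce; rewrite /E ge_max.
apply/andP; split; apply: l2norm_le_entries => i.
  have := ge i; rewrite loss_grad_col.
  by case: (split_ordP i) => l ->; rewrite /dual ?col_mxEu ?col_mxEd !mxE.
by rewrite complementarity_entry.
Qed.

Lemma E_entries w mu i :
  `|loss_grad M (primal w) i 0 - dual w i 0| <= E M w mu /\
  `|primal w i 0 * dual w i 0 - mu| <= E M w mu.
Proof.
split; rewrite /E le_max.
  apply/orP; left; apply: le_trans (ler_l2norm_entry _ i 0).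
  rewrite loss_grad_col.
  by case: (split_ordP i) => l ->; rewrite /dual ?col_mxEu ?col_mxEd !mxE.
apply/orP; right; apply: le_trans (ler_l2norm_entry _ i 0).
by rewrite complementarity_entry.
Qed.

(** The two errors are compared entrywise, where replacing [mu] by 0 costs
at most [mu]. *)
Lemma E_drop_barrier w mu : 0 <= mu ->
  E M w 0 <= (n * k + m * k)%:R * (E M w mu + mu).
Proof.
move=> mu0; apply: E_le => i; have [h1 h2] := E_entries w mu i.
  by apply: le_trans h1 _; rewrite lerDl.
rewrite subr0 -[X in `|X|](subrK mu); apply: le_trans (ler_normD _ _) _.
by rewrite (ger0_norm mu0) lerD2r.
Qed.

Lemma is_sigma_exists w d :
  positive w -> affine_direction M w d -> exists sigma, is_sigma M w sigma.
Proof.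
move=> /positiveE[z0 w0] dP.
have [a1 a1P] := max_step_exists (primal d) ltr01 z0.
have [a2 a2P] := max_step_exists (dual d) ltr01 w0.
by eexists; exists d, a1, a2; split; rewrite ?boundary_stepE.
Qed.

Lemma is_sigma_le w sigma : is_sigma M w sigma -> sigma <= 99 / 100.
Proof. by move=> [d [a1 [a2 [_ _ _ ->]]]]; rewrite ge_min lexx orbT. Qed.

Lemma inner_iteration_pos mu w w' : 0 < mu -> positive w ->
  inner_iteration M rho tau eta mu w w' -> positive w'.
Proof.
move=> mu0 w0 /(inner_iterationE _ mu0 w0) upd; apply/positiveE.
have [z0 r0] := (positiveE w).1 w0.
exact: pd_update_pos upd.
Qed.

Lemma inner_iteration_exists mu w : 0 < mu -> positive w ->
  exists w', inner_iteration M rho tau eta mu w w'.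
Proof.
move=> mu0 w0; have [z0 r0] := (positiveE w).1 w0.
have [z' [r' upd]] : exists z' r', update mu (primal w) (dual w) z' r'.
  apply: (pd_update_exists rho_gt0) => //; first exact: sq_loss_quadratic.
  exact: gn_matrix_coercive.
exists (Point (usubmx z') (dsubmx z') (usubmx r') (dsubmx r')).
by apply/inner_iterationE; rewrite // /primal /dual/= !vsubmxK.
Qed.

(** This is [pd_iteration_converges] for the factorization loss. *)
Lemma inner_loop_reaches mu tol (w : nat -> point) (B : R) :
  0 < mu -> 0 < tol -> positive (w 0%N) ->
  (forall N, [/\ l2norm (px (w N)) <= B, l2norm (py (w N)) <= B,
                 l2norm (pr (w N)) <= B & l2norm (ps (w N)) <= B]) ->
  (forall N, inner_iteration M rho tau eta mu (w N) (w N.+1)) ->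
  exists N, E M (w N) mu <= tol.
Proof.
move=> mu0 tol0 w0 wB it.
have pos N : positive (w N).
  by elim: N => [//|N IH]; exact: inner_iteration_pos (it N).
have upd N :
    update mu (primal (w N)) (dual (w N)) (primal (w N.+1)) (dual (w N.+1)).
  exact/inner_iterationE.
have zB N : l2norm (primal (w N)) <= B *+ 2.
  by have [? ? _ _] := wB N; exact: l2norm_col_mx_le.
have rB N : l2norm (dual (w N)) <= B *+ 2.
  by have [_ _ ? ?] := wB N; exact: l2norm_col_mx_le.
have [z0 r0] := (positiveE (w 0%N)).1 w0.
set p := (n * k + m * k)%N.
have e0 : 0 < tol / (p%:R + 1) by rewrite divr_gt0// ltr_wpDl.
have Hb : operator_bounded_on_balls (@gn_matrix R n m k rho).
  by apply: gn_matrix_bounded; exact: ltW.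
have [N hN] := pd_iteration_converges rho_gt0 tau_gt0 tau_lt1 eta_gt0 eta_lt1
  mu0 (sq_loss_ge0 M) (@sq_loss_quadratic R n m k M)
  (@loss_grad_bounded R n m k M) Hb (@gn_matrix_coercive R n m k rho)
  z0 r0 zB rB upd e0.
exists N.
apply: le_trans (E_le (fun i => (hN i).1) (fun i => (hN i).2)) _.
rewrite -/p mulrCA -[leRHS]mulr1 ler_wpM2l ?(ltW tol0)//.
by rewrite ler_pdivrMr ?ltr_wpDl// mul1r lerDl.
Qed.

End Algorithm.

(** * Executions *)

Section Execution.
Context (R : realType) (n m k : nat) (M : 'M[R]_(n, m))
  (rho tau eta eps_TOL : R) (eps : R -> R).
Hypotheses (rho_gt0 : 0 < rho) (tau_gt0 : 0 < tau) (tau_lt1 : tau < 1)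
  (eta_gt0 : 0 < eta) (eta_lt1 : eta < 1).
Local Notation step := (ip_step M rho tau eta eps_TOL eps).
Implicit Types cf : config R n m k.

Lemma ip_step_inv cf cf' : step cf cf' ->
  [\/ [/\ loc cf = OuterTest, loc cf' = InnerTest, iterate cf' = iterate cf &
          barrier cf' = barrier cf],
      [/\ loc cf = InnerTest, loc cf' = InnerTest, barrier cf' = barrier cf,
          eps (barrier cf) < E M (iterate cf) (barrier cf) &
          inner_iteration M rho tau eta (barrier cf) (iterate cf)
            (iterate cf')] |
      exists2 sigma, is_sigma M (iterate cf) sigma &
        [/\ predictor_call M eps cf, loc cf' = OuterTest,
            iterate cf' = iterate cf & barrier cf' = sigma * barrier cf]].
Proof.
case=> [w mu _|w w' mu h it|w mu sigma h hs]; [exact: Or31|exact: Or32|].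
by apply: Or33; exists sigma.
Qed.

(** Positive definiteness provides the primal-dual direction, positivity of the
iterate the step lengths, and the hypothesis the predictor direction; an
iteration asks for nothing else. *)
Lemma ip_step_exists cf :
  positive (iterate cf) -> (loc cf = InnerTest -> 0 < barrier cf) ->
  (predictor_call M eps cf -> exists d, affine_direction M (iterate cf) d) ->
  ~ stopped M eps_TOL cf -> exists cf', step cf cf'.
Proof.
case: cf => [[] w mu] /= w0 mu0 pred ns.
  exists (Config InnerTest w mu); constructor.
  by rewrite ltNge; apply/negP => h; apply: ns.
have [h|h] := leP (E M w mu) (eps mu).
  have [//|d dP] := pred.
  have [sigma hs] := is_sigma_exists w0 dP.
  by exists (Config OuterTest w (sigma * mu)); constructor.
have [w' it] :=
  inner_iteration_exists M rho_gt0 tau_gt0 tau_lt1 eta_lt1 (mu0 erefl) w0.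
by exists (Config InnerTest w' mu); constructor.
Qed.

Context (c : nat -> config R n m k).
Hypotheses (c_step : forall N, step (c N) (c N.+1))
  (c_barrier : forall N, loc (c N) = InnerTest -> 0 < barrier (c N))
  (c_bounded : bounded_iterates c)
  (eps_gt0 : forall mu, 0 < mu -> 0 < eps mu)
  (c_positive : forall N, positive (iterate (c N))).

(** Otherwise all later configurations belong to the same inner loop, and
[inner_loop_reaches] contradicts that its test always fails. *)
Lemma inner_loop_ends N : loc (c N) = InnerTest ->
  exists2 N', barrier (c N') = barrier (c N) & predictor_call M eps (c N').
Proof.
move=> locN; apply: contrapT => noend.
have mu0 := c_barrier locN.
have inner j : loc (c (N + j)%N) = InnerTest /\
               barrier (c (N + j)%N) = barrier (c N).
  elim: j => [|j [lj bj]]; first by rewrite addn0.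
  rewrite addnS; case: (ip_step_inv (c_step (N + j)%N)).
  - by case; rewrite lj.
  - by move=> [_ -> -> _ _].
  - by move=> [sigma _ [pc _ _ _]]; case: noend; exists (N + j)%N.
have it j : inner_iteration M rho tau eta (barrier (c N))
    (iterate (c (N + j)%N)) (iterate (c (N + j.+1)%N)).
  rewrite addnS; case: (ip_step_inv (c_step (N + j)%N)).
  - by case; rewrite (inner j).1.
  - by rewrite (inner j).2; case.
  - move=> [sigma _ [pc _ _ _]]; case: noend.
    by exists (N + j)%N; [exact: (inner j).2|].
have [B cB] := c_bounded.
have [j Ej] := inner_loop_reaches rho_gt0 tau_gt0 tau_lt1 eta_gt0 eta_lt1 mu0
  (eps_gt0 mu0) (c_positive (N + 0)%N) (fun j => cB (N + j)%N) it.
apply: noend; exists (N + j)%N; first exact: (inner j).2.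
by split; [exact: (inner j).1|rewrite (inner j).2].
Qed.

(** Between two consecutive ends of inner loops there is exactly one barrier
update. *)
Lemma barrier_decay mu0 : loc (c 0%N) = OuterTest -> barrier (c 0%N) = mu0 ->
  forall j, exists2 N, predictor_call M eps (c N) &
    barrier (c N) <= (99 / 100) ^+ j * mu0.
Proof.
move=> loc0 <-; elim=> [|j [N pc bN]].
  have [[_ l1 _ b1]|[]|[? _ [[]]]] := ip_step_inv (c_step 0%N); rewrite ?loc0//.
  have [N bN pc] := inner_loop_ends l1.
  by exists N => //; rewrite expr0 mul1r bN b1.
have [[]|[_ _ _ h _]|[sigma hs [_ l1 _ b1]]] := ip_step_inv (c_step N).
- by rewrite pc.1.
- by move: h; rewrite ltNge pc.2.
have [[_ l2 _ b2]|[]|[? _ [[]]]] := ip_step_inv (c_step N.+1); rewrite ?l1//.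
have [N' bN' pc'] := inner_loop_ends l2.
exists N' => //; rewrite bN' b2 b1 exprS -mulrA.
have b0 := c_barrier pc.1.
apply: (@le_trans _ _ (99 / 100 * barrier (c N))).
  by rewrite ler_wpM2r ?(ltW b0)//; exact: is_sigma_le hs.
by rewrite ler_wpM2l// divr_ge0.
Qed.

End Execution.

Unset Implicit Arguments.

Theorem theorem1 (R : realType) (n m k : nat) (hk : (1 <= k)%N)
    (M : 'M[R]_(n, m))
    (rho tau eta eps_TOL : R)
    (hrho : 0 < rho) (htau : 0 < tau < 1) (heta : 0 < eta < 1)
    (heps_TOL : 0 < eps_TOL)
    (eps : R -> R)
    (heps_pos : forall mu, 0 < mu -> 0 < eps mu)
    (heps_mono : forall mu mu', 0 < mu -> mu <= mu' -> eps mu <= eps mu')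
    (heps_lim : eps mu @[mu --> 0^'+] --> 0)
    (w0 : pd_point R n m k) (hw0 : positive w0)
    (mu0 : R) (hmu0 : 0 < mu0)
    (c : nat -> config R n m k)
    (hc : execution M rho tau eta eps_TOL eps w0 mu0 c)
    (* the predictor system has a solution whenever the algorithm calls for it *)
    (hpredictor : forall N, predictor_call M eps (c N) ->
       exists d, affine_direction M (iterate (c N)) d)
    (* the inner loop is only ever run with a positive barrier parameter *)
    (hbarrier : forall N, loc (c N) = InnerTest -> 0 < barrier (c N))
    (hbounded : bounded_iterates c) :
  exists N, stopped M eps_TOL (c N).
Proof.
move: htau heta hc => /andP[tau0 tau1] /andP[eta0 eta1] [c0 cS].
apply: contrapT => nstop.
have ns N : ~ stopped M eps_TOL (c N) by move=> h; apply: nstop; exists N.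
have progress N : positive (iterate (c N)) ->
    ip_step M rho tau eta eps_TOL eps (c N) (c N.+1).
  move=> pN; case: (cS N) => [//|[stuck _]]; case: stuck.
  exact: (ip_step_exists hrho tau0 tau1 eta1 pN (hbarrier N) (hpredictor N)
    (ns N)).
have pos N : positive (iterate (c N)).
  elim: N => [|N pN]; first by rewrite c0.
  case: (ip_step_inv (progress N pN)) =>
    [[_ _ -> _]//|[lN _ _ _ it]|[? _ [_ _ -> _]]//].
  exact: (inner_iteration_pos tau0 tau1 (hbarrier N lN) pN it).
have step N := progress N (pos N).
set p : R := (n * k + m * k)%:R.
(* It suffices that both the tolerance and the barrier parameter are at most e
   at the end of some inner loop. *)
pose e := eps_TOL / (2 * (p + 1)).
have p1 : 0 < p + 1 by rewrite ltr_wpDl.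
have e0 : 0 < e by rewrite divr_gt0// mulr_gt0.
have [r /= r0 hr] : exists2 r, 0 < r &
    forall mu, 0 < mu -> mu < r -> eps mu <= e.
  move/cvgrPdist_le : heps_lim => /(_ e e0)[r /= r0 hr].
  exists r => // mu mu_gt0 mur.
  have := hr mu; rewrite /= !sub0r !normrN (gtr0_norm mu_gt0).
  by move=> /(_ mur mu_gt0) /(le_trans (ler_norm _)).
pose s := Num.min e (r / 2).
have s0 : 0 < s by rewrite lt_min e0 divr_gt0.
have [j hj] : exists j, (99 / 100) ^+ j * mu0 <= s.
  have : geometric mu0 (99 / 100) @ \oo --> 0.
    by apply: cvg_geometric; rewrite ger0_norm; lra.
  move/cvgrPdist_le => /(_ s s0)[j _ hj].
  exists j; have := hj j (leqnn j); rewrite /= sub0r normrN mulrC.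
  exact: le_trans (ler_norm _).
have [N pc bN] := barrier_decay hrho tau0 tau1 eta0 eta1 step hbarrier hbounded
  heps_pos pos (congr1 (@loc _ _ _ _) c0) (congr1 (@barrier _ _ _ _) c0) j.
have b0 := hbarrier N pc.1.
have bs : barrier (c N) <= s by exact: le_trans hj.
have be : barrier (c N) <= e by rewrite (le_trans bs)// ge_min lexx.
have br : barrier (c N) < r.
  apply: le_lt_trans bs _; apply: (@le_lt_trans _ _ (r / 2)); last by lra.
  by rewrite ge_min lexx orbT.
case: (ip_step_inv (step N)) => [[]|[_ _ _ h _]|[sigma _ [_ l1 w1 _]]].
- by rewrite pc.1.
- by move: h; rewrite ltNge pc.2.
apply: nstop; exists N.+1; split=> //; rewrite w1.
apply: le_trans (E_drop_barrier M (iterate (c N)) (ltW b0)) _.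
apply: (@le_trans _ _ ((p + 1) * (e + e))).
  rewrite ler_pM// ?lerDl// ?addr_ge0 ?(ltW b0)//.
    by rewrite le_max l2norm_ge0.
  by rewrite lerD// (le_trans pc.2)// hr.
by rewrite /e le_eqVlt; apply/orP; left; apply/eqP; field; rewrite gt_eqF.
Qed.
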